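(* Let $X$ be a standard Gaussian in $H$, and let $(\mathcal T,\mu)$ be a standard probability space. Let $Y$ be a randomized shift defined on $(\mathcal T,\mu)$. Then for every $n\in\mathbb N$ there is a probability measure $\mu_n'$ on $\mathcal T$ equivalent to $\mu$ such that under $\mu_n'$ all $\langle Y,\xi\rangle$, $\xi\in H$, have finite absolute $n$-th moment, and the symmetric tensor $\mathbb E_{\mu_n'}Y^{\otimes n}$, defined by the polarization of $\xi\mapsto\mathbb E_{\mu_n'}\langle Y,\xi\rangle^n$, is Hilbert–Schmidt.
   Context: $H$ is a separable infinite-dimensional real Hilbert space with a fixed orthonormal basis $(e_n)$; $(\Omega,\mathcal F,\mathbb P)$ is a standard probability space. $L^0(\mathcal T,\mu)$ is the space of $\mu$-equivalence classes of real measurable functions with the topology of convergence in measure. A generalized $H$-valued function on $(\mathcal T,\mu)$ is a continuous linear operator $Y:H\to L^0(\mathcal T,\mu)$, $\xi\mapsto\langle Y,\xi\rangle$; $\langle Y(t),\xi\rangle$ denotes the value of $\langle Y,\xi\rangle$ at $t$. If defined on $(\Omega,\mathbb P)$ it is called a generalized random vector. $Y(t)$ is identified with $(\langle Y(t),e_n\rangle)_n\in\mathbb R^\infty$. A standard Gaussian $X$ in $H$ is a generalized random vector on $(\Omega,\mathbb P)$ such that each $\langle X,\xi\rangle$ is centered Gaussian with variance $\|\xi\|^2$. A generalized $H$-valued function $Y$ on $(\mathcal T,\mu)$ is a randomized shift if $\mathrm{Law}_{\mathbb P\otimes\mu}[X+Y]\ll\mathrm{Law}_{\mathbb P}[X]$,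 where $\mathrm{Law}_{\mathbb P\otimes\mu}[X+Y]$ is the push-forward of $\mathbb P\otimes\mu$ under $(\omega,t)\mapsto X(\omega)+Y(t)\in\mathbb R^\infty$. $H^{\otimes n}$ is the Hilbert $n$-th tensor power of $H$ (completion of the algebraic one for $\langle\xi_1\otimes\dots\otimes\xi_n,\eta_1\otimes\dots\otimes\eta_n\rangle=\prod_i\langle\xi_i,\eta_i\rangle$), whose elements are called Hilbert–Schmidt tensors. That $\mathbb E_{\mu_n'}Y^{\otimes n}$ is Hilbert–Schmidt means that the symmetric $n$-linear form $(\xi_1,\dots,\xi_n)\mapsto\mathbb E_{\mu_n'}\big[\langle Y,\xi_1\rangle\cdots\langle Y,\xi_n\rangle\big]$ on $H$ is given by scalar product of $\xi_1\otimes\dots\otimes\xi_n$ with an element of $H^{\otimes n}$, i.e. $\sum_{i_1,\dots,i_n}\big(\mathbb E_{\mu_n'}[\langle Y,e_{i_1}\rangle\cdots\langle Y,e_{i_n}\rangle]\big)^2<\infty$. $\mathbb E_{\nu}$ is expectation with respect to $\nu$. *)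

(* Defs.v *)
From HB Require Import structures.
From mathcomp Require Import all_boot all_order all_algebra.
From mathcomp Require Import all_classical all_reals all_analysis.

Set Implicit Arguments.
Unset Strict Implicit.
Unset Printing Implicit Defensive.

Import Order.TTheory GRing.Theory Num.Theory.
Import numFieldNormedType.Exports.

Local Open Scope classical_set_scope.
Local Open Scope ring_scope.

(** * Hilbert space *)

(* A [completeNormedModType] with such an inner product is a real Hilbert
   space. *)
Definition dot_induces_norm (R : realType) (H : completeNormedModType R)
    (ip : {dot H for @idfun R}) : Prop :=
  forall x : H, ip x x = `|x| ^+ 2.

(* A basis indexed by [nat] makes [H] separable and infinite-dimensional. *)
Definition orthonormal_basis (R : realType) (H : completeNormedModType R)
    (ip : {dot H for @idfun R}) (e : nat -> H) : Prop :=
  (forall i j, ip (e i) (e j) = (i == j)%:R) /\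
  (forall x, series (fun k => ip x (e k) *: e k) @ \oo --> x).

(** * Standard probability spaces *)

(* Lebesgue-Rokhlin spaces: up to a null set, [f] is an isomorphism onto the
   real line carrying the law of [f], both sides being completed.  Images of
   measurable sets are only required to be measurable for the completion of the
   law, so that standard Borel probability spaces, their completions and
   everything in between are all covered. *)
Definition standard_probability d (T : measurableType d) (R : realType)
    (mu : probability T R) : Prop :=
  exists (f : {mfun T >-> measurableTypeR R}) (T0 : set T),
    [/\ measurable T0, mu (~` T0) = 0%E, {in T0 &, injective f} &
      forall A : set T, measurable A -> A `<=` T0 ->
        exists B : set (measurableTypeR R), measurable B /\
          (distribution mu f).-negligible ((f @` A) `+` B)].

(** * Generalized functions *)

Definition L0 d (T : measurableType d) (R : realType) (mu : probability T R) :
  Type := {mfun_ mu, T >-> measurableTypeR R}.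

(* the values of a chosen representative *)
Definition L0_fun d (T : measurableType d) (R : realType)
  (mu : probability T R) (f : L0 mu) : T -> R := aqEqMfun_to_fun f.
Coercion L0_fun : L0 >-> Funclass.

(* Equality in [L0 mu] is almost everywhere equality; the sets
   [set g | mu {eps <= |g - f|} < delta] form a neighbourhood base of [f] for
   the topology of convergence in measure. *)
Definition generalized_function (R : realType) (H : completeNormedModType R)
    d (T : measurableType d) (mu : probability T R) (Y : H -> L0 mu) : Prop :=
  (forall (a : R) (u v : H),
     {ae mu, forall t, Y (a *: u + v) t = a * Y u t + Y v t}) /\
  (forall (xi : H) (eps : R), 0 < eps ->
     mu [set t | eps <= `|Y eta t - Y xi t|] @[eta --> xi] --> 0%E).

(* [normal_prob m s] is not a Dirac mass when [s = 0]. *)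
Definition centered_gaussian (R : realType) (s : R)
    (A : set (measurableTypeR R)) : \bar R :=
  if s == 0 then \d_(0 : measurableTypeR R) A else normal_prob 0 s A.

Definition standard_gaussian (R : realType) (H : completeNormedModType R)
    d (Omega : measurableType d) (P : probability Omega R) (X : H -> L0 P) :
    Prop :=
  generalized_function X /\
  forall (xi : H) (A : set (measurableTypeR R)), measurable A ->
    pushforward P (X xi : Omega -> measurableTypeR R) A = centered_gaussian `|xi| A.

(** * Randomized shifts *)

Definition cylinders (R : realType) : set (set (nat -> R)) :=
  [set A | exists (n : nat) (B : set (measurableTypeR R)),
     measurable B /\ A = [set x | B (x n)]].

(* [R^oo] with its product sigma-algebra *)
Definition Rinfty (R : realType) := g_sigma_algebraType (@cylinders R).

Definition Rinfty_coord (R : realType) (H : completeNormedModType R) (e : nat -> H)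
    d (T : measurableType d) (mu : probability T R) (Y : H -> L0 mu) (t : T) :
    nat -> R :=
  fun n => Y (e n) t.

Definition randomized_shift (R : realType) (H : completeNormedModType R)
    (e : nat -> H) d1 (Omega : measurableType d1) (P : probability Omega R)
    (X : H -> L0 P) d2 (T : measurableType d2) (mu : probability T R)
    (Y : H -> L0 mu) : Prop :=
  generalized_function Y /\
  pushforward (P \x mu)%E
      ((fun w n => Rinfty_coord e X w.1 n + Rinfty_coord e Y w.2 n) :
         Omega * T -> Rinfty R)
  `<< pushforward P (Rinfty_coord e X : Omega -> Rinfty R).

(** * Hilbert-Schmidt tensors *)

(* The [n]-linear form [(xi_1, .., xi_n) |-> E_nu [<Y, xi_1> .. <Y, xi_n>]],
   i.e. the polarization of [xi |-> E_nu <Y, xi> ^ n]. *)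
Definition moment_form (R : realType) (H : completeNormedModType R)
    d (T : measurableType d) (mu : probability T R) (Y : H -> L0 mu)
    (nu : probability T R) (n : nat) (xi : 'I_n -> H) : R :=
  fine 'E_nu[(fun t => \prod_(k < n) Y (xi k) t)%R]%E.

(* An element [a] of the Hilbert tensor power of [H] is given by its
   coordinates in the orthonormal basis of the [e_{i_1} (x) .. (x) e_{i_n}], an
   arbitrary square-summable array; its scalar product with
   [xi_1 (x) .. (x) xi_n] is the absolutely convergent sum
   [\sum_i a_i \prod_k <xi_k, e_{i_k}>], here exhausted by the cubes
   [{0, .., N-1}^n]. *)
Definition hilbert_schmidt (R : realType) (H : completeNormedModType R)
    (ip : {dot H for @idfun R}) (e : nat -> H) (n : nat)
    (F : ('I_n -> H) -> R) : Prop :=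
  exists a : {ffun 'I_n -> nat} -> R,
    (\esum_(i in [set: {ffun 'I_n -> nat}]) ((a i) ^+ 2)%:E < +oo)%E /\
    forall xi : 'I_n -> H,
      (fun N : nat => \sum_(i : {ffun 'I_n -> 'I_N})
         a [ffun k => val (i k)] * \prod_(k < n) ip (xi k) (e (i k)))
      @ \oo --> F xi.

(* Main.v *)
Require Import Defs.
From HB Require Import structures.
From mathcomp Require Import all_boot all_order all_algebra.
From mathcomp Require Import all_classical all_reals all_analysis.
From mathcomp Require Import measurable_realfun.
From mathcomp Require Import ring lra.

Set Implicit Arguments.
Unset Strict Implicit.
Unset Printing Implicit Defensive.

Import Order.TTheory GRing.Theory Num.Theory.
Import numFieldNormedType.Exports.

Local Open Scope classical_set_scope.
Local Open Scope ring_scope.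

(** Let [D] be the density of the law of [X + Y] with respect to the law of [X],
    and [w := exp (- D)].  As [D exp (- D) <= 1], every [h >= 0] satisfies
      [E_(P x mu) (w (X + Y) h (X + Y)) = E_P (D (X) w (X) h (X)) <= E_P (h (X))],
    so functions of [X + Y] have, under the weight, moments dominated by
    Gaussian ones ([dominated_weight]).  Averaging the weight over [X] gives a
    positive function of the parameter alone, [rho (t) := E_P (w (X + Y (t)))].
    The measure is [mu' := c rho^n mu], and both claims follow from the
    inequality
      [E_mu (rho^n <Y^(x n), A>^2) <= C_n |A|^2]      ([weighted_tensor_bound])
    for all finitely supported tensors [A], with [C_n] independent of [A].

    The inequality is proved for tensors some of whose slots [J] are filled by
    [Y], with weight [rho^#|J|], and whose other slots are filled by
    independent standard Gaussian vectors, by induction on [#|J|]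
    ([weighted_mean_form_bound]).  When [J] is empty, orthogonality gives a
    multiple of [|A|^2] ([tensor_form0_sqr_integral]).  For the induction step
    one needs a multilinear function of Gaussian variables, so that its mean
    square is again a multiple of [|A|^2], which contains [X] in such a way
    that replacing [X] by [X + Y] produces [Y] in the slots of [J].  Wick powers
    would do; it is simpler to adjoin to [X] one independent Gaussian vector
    per slot and to apply to all of them an orthogonal reflection ([reflected]).
    The reflected vectors, one per slot, are again independent and standard; a
    shift of [X] by [y] shifts those of the slots in [J] by a fixed nonzero
    multiple of [y], and leaves the others alone.  Expanding the shifted
    multilinear form over the subsets of slots that receive [Y]
    ([tensor_form_shift]), the term of [J] is a combination of the whole form
    and of the terms of the proper subsets of [J].  Under the weight
    [w (X + Y) rho^(#|J| - 1)] the whole form is controlled by the density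
    inequality, and the proper subsets by the induction hypothesis, since
    [w <= 1].  The term of [J] itself does not involve [X] any more, so that
    integrating [X] out turns [w (X + Y)] into the missing factor [rho].

    Only the one-dimensional laws of [X] are given.  They determine the joint
    moment generating function of the coordinates, which determines all joint
    moments ([gaussian_monomial_eq]); independence of the coordinates is used
    only in the form of equalities between moments.

    The inequality for [A := E_mu' (Y^(x n))], truncated, bounds the
    Hilbert-Schmidt norm of that tensor ([moment_esum]).  Applied to truncations
    of [xi_1 (x) .. (x) xi_n], it makes the products of truncated coordinates a
    Cauchy sequence in [L^2 (mu')]; continuity of [Y] identifies an almost sure
    limit along a subsequence, and Fatou's lemma identifies the limit in
    [L^2 (mu')] ([truncated_product_mean_cvg]). *)

(** * Densities, almost sure limits, square integrability *)

Lemma integral_density (R : realType) d (T : measurableType d)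
    (nu : {finite_measure set T -> \bar R})
    (mu : {sigma_finite_measure set T -> \bar R}) (g : T -> \bar R)
    (ig : mu.-integrable setT g)
    (nuE : forall A, measurable A -> nu A = (\int[mu]_(x in A) g x)%E)
    (f : T -> \bar R) :
  (forall x, 0 <= f x)%E -> measurable_fun setT f ->
  (\int[nu]_x f x = \int[mu]_x (f x * g x))%E.
Proof.
move=> f0 mf.
have numu : nu `<< mu.
  apply/null_content_dominatesP => A mA muA0; rewrite nuE //.
  apply: null_set_integral => //.
  by apply: measurable_int (integrableS measurableT mA (@subsetT _ _) ig).
have mg := measurable_int _ ig.
rewrite -(Radon_Nikodym_SigmaFinite.change_of_variables numu) //.
have mrn : measurable_fun setT (Radon_Nikodym_SigmaFinite.f nu mu).
  by apply: measurable_int; exact: Radon_Nikodym_SigmaFinite.f_integrable.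
apply: ae_eq_integral => //; try exact: emeasurable_funM.
apply: ae_eqe_mul2l; apply: integral_ae_eq => //.
  exact: Radon_Nikodym_SigmaFinite.f_integrable.
move=> A _ mA.
by rewrite -Radon_Nikodym_SigmaFinite.f_integral // nuE.
Qed.

Section MeasureTools.
Context (R : realType) d (T : measurableType d).

Lemma exists_density_probability (mu : probability T R) (g : T -> R) :
  measurable_fun setT g -> (forall t, 0 < g t <= 1) ->
  exists nu : probability T R, exists2 c : R, 0 < c &
    [/\ nu `<< mu, mu `<< nu & forall f : T -> \bar R,
      (forall t, 0 <= f t)%E -> measurable_fun setT f ->
      (\int[nu]_t f t = c%:E * \int[mu]_t (f t * (g t)%:E))%E].
Proof.
move=> mg g01.
have g0 t : 0 < g t by have /andP[] := g01 t.
have gE0 t : (0 <= (g t)%:E)%E by rewrite lee_fin ltW.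
have mgE : measurable_fun setT (fun t => (g t)%:E) by exact/measurable_EFinP.
have g_null A : measurable A -> (\int[mu]_(t in A) (g t)%:E = 0)%E -> mu A = 0%E.
  move=> mA gA.
  have : ae_eq mu A (fun t => (g t)%:E) (cst 0%E).
    apply/ae_eq_integral_abs => //; first exact: measurable_funTS.
    by under eq_integral do rewrite gee0_abs //.
  move=> h; apply: measure_negligible => //; apply: negligibleS h => t At /= /(_ At).
  by case=> gt0; have := g0 t; rewrite gt0 ltxx.
pose s := (\int[mu]_t (g t)%:E)%E.
have s1 : (s <= 1)%E.
  rewrite -(probability_setT mu) -[leRHS]mul1e -integral_cst //.
  by apply: ge0_le_integral => // t _; rewrite lee_fin; have /andP[] := g01 t.
have sfin : s \is a fin_num.
  by rewrite ge0_fin_numE ?(le_lt_trans s1) ?ltry // integral_ge0.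
have s0 : 0 < fine s.
  rewrite fine_gt0 // (le_lt_trans s1) ?ltry // andbT lt_neqAle integral_ge0 // andbT eq_sym.
  apply/negP => /eqP /(g_null _ measurableT) /eqP.
  by rewrite probability_setT onee_eq0.
pose c := (fine s)^-1.
have c0 : 0 < c by rewrite invr_gt0.
have cgE0 t : (0 <= c%:E * (g t)%:E)%E by rewrite mule_ge0 // lee_fin ltW.
have mcg : measurable_fun setT (fun t => (c%:E * (g t)%:E)%E).
  exact: emeasurable_funM.
have int_cg : (\int[mu]_t (c%:E * (g t)%:E) = 1)%E.
  rewrite ge0_integralZl // ?lee_fin ?ltW //.
  by rewrite -/s -(fineK sfin) -EFinM mulVf ?gt_eqF.
pose m A := (\int[mu]_(t in A) (c%:E * (g t)%:E))%E.
have m0 : m set0 = 0%E by rewrite /m integral_set0.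
have m_ge0 A : (0 <= m A)%E by exact: integral_ge0.
have m_sigma : semi_sigma_additive m.
  move=> /= F mF tF mUF; rewrite /m; apply: cvg_toP.
    apply: ereal_nondecreasing_is_cvgn => i j ij.
    by apply: lee_sum_nneg_natr => // k _ _; exact: integral_ge0.
  by rewrite ge0_integral_bigcup //=; exact: measurable_funTS.
have m1 : m setT = 1%E by [].
pose nu0 : {measure set T -> \bar R} := HB.pack m
  (isMeasure.Build _ _ _ m m0 m_ge0 m_sigma).
pose nu : probability T R := HB.pack m
  (isMeasure.Build _ _ _ m m0 m_ge0 m_sigma) (Measure_isProbability.Build _ _ _ nu0 m1).
exists nu, c => //; split.
- apply/null_content_dominatesP => A mA muA0.
  apply: null_set_integral => //; exact: measurable_funTS.
- apply/null_content_dominatesP => A mA nuA0; apply: g_null => //.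
  have : (c%:E * \int[mu]_(t in A) (g t)%:E = 0)%E.
    rewrite -ge0_integralZl // ?lee_fin ?ltW //; exact: measurable_funTS.
  by move=> /eqP; rewrite mule_eq0 eqe gt_eqF //= => /eqP.
- move=> f f0 mf.
  rewrite (@integral_density _ _ _ nu mu (fun t => c%:E * (g t)%:E)%E) //.
    rewrite -ge0_integralZl // ?lee_fin ?ltW //.
    + by apply: eq_integral => t _; rewrite muleCA.
    + exact: emeasurable_funM.
    + by move=> t _; rewrite mule_ge0.
  apply/integrableP; split => //.
  by under eq_integral do rewrite gee0_abs //; rewrite int_cg ltry.
Qed.

(** Almost sure convergence is allowed along the way because convergence in
    measure only gives almost sure convergence along a subsequence. *)
Lemma fatou_ae (mu : {measure set T -> \bar R}) (f : nat -> T -> R) (g : T -> R)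
    (B : \bar R) :
  (forall j, measurable_fun setT (f j)) -> measurable_fun setT g ->
  (forall j t, 0 <= f j t) -> (forall t, 0 <= g t) ->
  {ae mu, forall t, f j t @[j --> \oo] --> g t} ->
  (forall j, (\int[mu]_t (f j t)%:E <= B)%E) -> (\int[mu]_t (g t)%:E <= B)%E.
Proof.
move=> mf mg f0 g0 fg fB.
pose F j t := (f j t)%:E.
have mF j : measurable_fun setT (F j) by exact/measurable_EFinP.
have F0 j t : setT t -> (0 <= F j t)%E by move=> _; rewrite lee_fin.
have := fatou mu measurableT mF F0.
have -> : (\int[mu]_t limn_einf (F^~ t) = \int[mu]_t (g t)%:E)%E.
  apply: ae_eq_integral => //.
  - rewrite (_ : (fun t => _) = fun t => (- limn_esup (fun j => - F j t))%E).
      apply: measurableT_comp => //; apply: measurable_fun_limn_esup => j.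
      exact: measurableT_comp.
    apply/funext => t; rewrite -limn_einfN; congr limn_einf.
    by apply/funext => j /=; rewrite opprK.
  - exact/measurable_EFinP.
  apply: filterS fg => t fgt _.
  have h : F^~ t @ \oo --> (g t)%:E.
    by apply/fine_cvgP; split; [exact: nearW|exact: fgt].
  rewrite is_cvg_limn_einfE; last by apply/cvg_ex; exists (g t)%:E.
  exact/cvg_lim.
move=> /le_trans; apply.
rewrite limn_einf_lim; apply: lime_le; first exact: is_cvg_einfs.
apply: nearW => j; apply: le_trans (fB j).
by apply: ereal_inf_lbound; exists j => /=.
Qed.

(** By Borel-Cantelli; finitely many sequences share one subsequence, which is
    what a product of finitely many of them requires. *)
Lemma cvg_measure_subseq_ae (mu : probability T R) (K : finType)
    (F : K -> nat -> T -> R) (G : K -> T -> R) :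
  (forall k j, measurable_fun setT (F k j)) -> (forall k, measurable_fun setT (G k)) ->
  (forall k eps, 0 < eps ->
    mu [set t | eps <= `|F k j t - G k t|] @[j --> \oo] --> 0%E) ->
  exists phi : nat -> nat, (forall j, (j <= phi j)%N) /\
    {ae mu, forall t, forall k, F k (phi j) t @[j --> \oo] --> G k t}.
Proof.
move=> mF mG FG.
pose eps j : R := 1 / (2 ^ j.+1)%:R.
have eps0 j : 0 < eps j by rewrite divr_gt0 // ltr0n expn_gt0.
have /choice[phi hphi] : forall j, exists N : nat, (j <= N)%N /\
    forall k, (mu [set t | (eps j <= `|F k N t - G k t|)%R] <= (eps j)%:E)%E.
  move=> j.
  have : \forall N \near \oo, forall k,
      (mu [set t | (eps j <= `|F k N t - G k t|)%R] <= (eps j)%:E)%E.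
    apply: filter_forall => k.
    have /fine_cvgP[fin cvg0] := FG k (eps j) (eps0 j).
    apply: filterS2 fin (cvgr0_norm_le _ cvg0 _ (eps0 j)) => N fin; rewrite /= ger0_norm ?fine_ge0 //.
    by move=> h; rewrite -(fineK fin) lee_fin.
  move=> [N0 _ hN0]; exists (maxn j N0); rewrite leq_maxl; split => //.
  by apply: hN0; exact: leq_maxr.
exists phi; split=> [j|]; first by have [] := hphi j.
apply: filter_forall => k.
pose bad j := [set t | eps j <= `|F k (phi j) t - G k t|].
have mbad j : measurable (bad j).
  have mFG : measurable_fun setT (fun t => `|F k (phi j) t - G k t|).
    by apply: measurableT_comp => //; exact: measurable_funB.
  rewrite (_ : bad j = setT `&` (fun t => `|F k (phi j) t - G k t|) @^-1`
      `[eps j, +oo[%classic); first exact: mFG.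
  by apply/seteqP; split => t /=; rewrite in_itv /= andbT => // -[].
have : mu (lim_sup_set bad) = 0%E.
  apply: lim_sup_set_cvg0 => //.
  apply: (@le_lt_trans _ _ 1%E); last exact: ltry.
  apply: le_trans (epsilon_trick0 xpredT ler01).
  apply: lee_nneseries => // j _ /=; exact: (hphi j).2.
move=> h; exists (lim_sup_set bad); split => //.
  apply: bigcap_measurable => // i _; exact: bigcup_measurable.
move=> t /= nt; apply: contrapT => nbad; apply: nt.
have [i hi] : exists i, forall j, (i <= j)%N -> `|F k (phi j) t - G k t| < eps j.
  apply: contrapT => ex; apply: nbad => i _.
  apply: contrapT => ni; apply: ex; exists i => j ij.
  rewrite ltNge; apply/negP => bj; apply: ni.
  by exists j.
have cvg_eps : eps @ \oo --> (0 : R).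
  rewrite (_ : eps = geometric (2^-1) (2^-1)); last first.
    apply/funext => j; rewrite /eps /geometric /= -exprS natrX.
    by rewrite exprVn div1r.
  by apply: cvg_geometric; rewrite ger0_norm ?invr_ge0 // invf_lt1 // ltr1n.
apply/cvgrPdist_lt => del del0.
have hnear : \forall j \near \oo, (i <= j)%N by exact: nbhs_infty_ge.
apply: filterS2 hnear (cvgr0_norm_lt _ cvg_eps _ del0) => j ij; rewrite ger0_norm ?(ltW (eps0 j)) //.
by rewrite distrC; apply: lt_trans; exact: hi.
Qed.

End MeasureTools.

Lemma ae_dominates (R : realType) d (T : measurableType d)
    (mu nu : probability T R) (Q : T -> Prop) :
  nu `<< mu -> {ae mu, forall t, Q t} -> {ae nu, forall t, Q t}.
Proof.
move=> /null_content_dominatesP numu [N [mN muN0 QN]].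
by exists N; split => //; exact: numu.
Qed.

(** The inequality [2 |f| <= eps + eps^-1 f^2] replaces Cauchy-Schwarz: the
    choice of [eps] is left to the applications. *)
Lemma sqr_integrable_bound (R : realType) d (T : measurableType d)
    (nu : probability T R) (f : T -> R) (b : R) :
  measurable_fun setT f -> (\int[nu]_t (f t ^+ 2)%:E <= b%:E)%E ->
  nu.-integrable setT (EFin \o f) /\
  forall eps, 0 < eps -> `|\int[nu]_t f t| <= (eps + eps^-1 * b) / 2.
Proof.
move=> mf fb.
have if2 : nu.-integrable setT (EFin \o (fun t => f t ^+ 2)).
  apply/integrableP; split; first exact/measurable_EFinP/measurable_funX.
  under eq_integral do rewrite /= ger0_norm ?sqr_ge0 //.
  by rewrite (le_lt_trans fb) // ltry.
have icst c : nu.-integrable setT (EFin \o (fun _ : T => c)).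
  by apply: finite_measure_integrable_cst.
have igen eps : nu.-integrable setT (EFin \o (fun t => (eps + eps^-1 * f t ^+ 2) / 2)).
  have := integrableZr measurableT 2^-1
    (integrableD measurableT (icst eps) (integrableZl measurableT eps^-1 if2)).
  exact: eq_integrable.
have bound eps t : 0 < eps -> `|f t| <= (eps + eps^-1 * f t ^+ 2) / 2.
  move=> eps0; rewrite -[f t ^+ 2]ger0_norm ?sqr_ge0 // normrX.
  have : 0 <= eps^-1 * (`|f t| - eps) ^+ 2 by rewrite mulr_ge0 ?sqr_ge0 // invr_ge0 ltW.
  have -> : eps^-1 * (`|f t| - eps) ^+ 2 = eps + eps^-1 * `|f t| ^+ 2 - 2 * `|f t|.
    by field; rewrite gt_eqF.
  lra.
have intf : nu.-integrable setT (EFin \o f).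
  apply: (le_integrable measurableT _ _ (igen 1)); first exact/measurable_EFinP.
  move=> t _ /=; rewrite lee_fin (le_trans (bound 1 t ltr01)) // ler_norm //.
split => // eps eps0.
apply: le_trans (le_normr_Rintegral measurableT intf) _.
apply: (@le_trans _ _ (\int[nu]_t ((eps + eps^-1 * f t ^+ 2) / 2))).
  apply: le_Rintegral => //; first exact: integrable_norm.
  by move=> t _; exact: bound.
rewrite RintegralZr //; last first.
  exact: (integrableD measurableT (icst eps) (integrableZl measurableT eps^-1 if2)).
rewrite RintegralD //; last exact: (integrableZl measurableT eps^-1 if2).
rewrite RintegralZl // Rintegral_cst // [X in fine X]probability_setT mulr1.
rewrite ler_pM2r // lerD2l ler_pM2l ?invr_gt0 // -lee_fin fineK //.
exact: integrable_fin_num.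
Qed.

(** * Gaussian systems and comparison of their moments *)

Lemma expR_second_order (R : realType) (u : R) :
  `|expR u - 1 - u| <= u ^+ 2 * (expR u + expR (- u)).
Proof.
have h1 := expR_ge1Dx u; have h2 := expR_ge1Dx (- u).
have e0 := expR_gt0 u; have e0' := expR_gt0 (- u).
have ee : expR u * expR (- u) = 1 by rewrite -expRD subrr expR0.
rewrite ger0_norm; last lra.
have up : expR u - 1 <= u * expR u.
  have : (1 - u) * expR u <= expR (- u) * expR u by rewrite ler_pM2r.
  by rewrite mulrC in ee; rewrite ee; lra.
have [u0|u0] := lerP 0 u.
  have : u * (expR u - 1) <= u * (u * expR u) by rewrite ler_wpM2l.
  have : 0 <= u ^+ 2 * expR (- u) by rewrite mulr_ge0 ?sqr_ge0 // ltW.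
  by rewrite mulrDr expr2; lra.
have : - u * (1 - expR u) <= - u * - u.
  by rewrite ler_wpM2l //; [lra|lra].
have : 1 <= expR (- u) by lra.
move=> h3; have : u ^+ 2 * 1 <= u ^+ 2 * (expR u + expR (- u)).
  by rewrite ler_wpM2l ?sqr_ge0 //; lra.
by rewrite expr2; lra.
Qed.

Lemma normr_le_expR2 (R : realType) (u : R) : `|u| <= expR u + expR (- u).
Proof.
have h1 := expR_ge1Dx u; have h2 := expR_ge1Dx (- u).
have e0 := expR_gt0 u; have e0' := expR_gt0 (- u).
by rewrite ler_norml; apply/andP; split; lra.
Qed.

(** Independent standard Gaussian variables, encoded by their joint moment
    generating function, since this is what one-dimensional laws of linear
    combinations give directly. *)
Definition gaussian_system (R : realType) d (O : measurableType d)
    (P : probability O R) (K : finType) (z : K -> O -> R) : Prop :=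
  (forall a, measurable_fun setT (z a)) /\
  forall c : K -> R, (\int[P]_w (expR (\sum_a c a * z a w))%:E =
                      (expR (\sum_a (c a) ^+ 2 / 2))%:E)%E.

Section GaussianSystem.
Context (R : realType) d (O : measurableType d) (P : probability O R)
  (K : finType) (z : K -> O -> R).
Hypothesis hz : gaussian_system P z.

Let cosh2 a w := expR (z a w) + expR (- z a w).

Let cosh2_ge0 a w : 0 <= cosh2 a w.
Proof. by rewrite addr_ge0 ?expR_ge0. Qed.

Let mz a : measurable_fun setT (z a) := hz.1 a.

Let mlin (c : K -> R) : measurable_fun setT (fun w => \sum_a c a * z a w).
Proof. by apply: measurable_sum => a; apply: measurable_funM. Qed.

Let mcosh2 a : measurable_fun setT (cosh2 a).
Proof.
apply: measurable_funD; apply: measurableT_comp => //.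
exact: measurableT_comp.
Qed.

Let mexp c : measurable_fun setT (fun w => expR (\sum_a c a * z a w)).
Proof. exact: measurableT_comp. Qed.

Let mdom s c : measurable_fun setT
  (fun w => (\prod_(a <- s) cosh2 a w) * expR (\sum_a c a * z a w)).
Proof. by apply: measurable_funM => //; apply: measurable_prod => a _. Qed.

Let shift_coef (c : K -> R) (b : K) (h : R) w :
  expR (\sum_a c a * z a w) * expR (h * z b w) =
  expR (\sum_a (c a + h * (a == b)%:R) * z a w).
Proof.
rewrite -expRD; congr expR.
under [RHS]eq_bigr do rewrite mulrDl.
rewrite big_split /=; congr (_ + _).
rewrite (bigD1 b) //= eqxx mulr1 big1 ?addr0 // => a /negbTE ->.
by rewrite mulr0 mul0r.
Qed.

(** Powers of [exp (z) + exp (- z)] are sums of exponentials of linear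
   combinations, hence integrable, and they dominate all polynomials. *)
Let dom_integrable s c : P.-integrable setT
  (fun w => ((\prod_(a <- s) cosh2 a w) * expR (\sum_a c a * z a w))%:E).
Proof.
elim: s c => [|b s IH] c.
  apply/integrableP; split; first exact/measurable_EFinP.
  under eq_integral do
    rewrite big_nil mul1r gee0_abs ?lee_fin ?expR_ge0 //.
  by rewrite hz.2 ltry.
have := integrableD measurableT (IH (fun a => c a + 1 * (a == b)%:R))
  (IH (fun a => c a + (-1) * (a == b)%:R)).
apply: eq_integrable => // w _.
rewrite -!shift_coef -EFinD big_cons; congr EFin.
by rewrite mul1r mulN1r /cosh2; ring.
Qed.

Let mono_bound s c w : `|(\prod_(a <- s) z a w) * expR (\sum_a c a * z a w)| <=
  (\prod_(a <- s) cosh2 a w) * expR (\sum_a c a * z a w).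
Proof.
rewrite normrM (ger0_norm (expR_ge0 _)) ler_wpM2r ?expR_ge0 //.
rewrite normr_prod; apply: ler_prod => a _.
by rewrite normr_ge0 normr_le_expR2.
Qed.

Lemma gaussian_monomial_integrable s c : P.-integrable setT
  (fun w => ((\prod_(a <- s) z a w) * expR (\sum_a c a * z a w))%:E).
Proof.
apply: (le_integrable measurableT _ _ (dom_integrable s c)).
  apply/measurable_EFinP; apply: measurable_funM => //.
  by apply: measurable_prod => a _.
move=> w _ /=; rewrite lee_fin (le_trans (mono_bound _ _ _)) // ler_norm //.
Qed.

Let expansion_bound b s c (h : R) w : `|h| <= 1 ->
  `|((\prod_(a <- s) z a w) * expR (\sum_a (c a + h * (a == b)%:R) * z a w))
    - ((\prod_(a <- s) z a w) * expR (\sum_a c a * z a w))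
    - h * ((\prod_(a <- b :: s) z a w) * expR (\sum_a c a * z a w))| <=
  h ^+ 2 * ((\prod_(a <- [:: b, b, b & s]) cosh2 a w)
             * expR (\sum_a c a * z a w)).
Proof.
move=> h1; rewrite -shift_coef !big_cons.
set G := \prod_(a <- s) z a w; set Q := \prod_(a <- s) _; set e := expR (\sum_a _).
have -> : G * (e * expR (h * z b w)) - G * e - h * (z b w * G * e) =
  G * e * (expR (h * z b w) - 1 - h * z b w) by ring.
rewrite normrM.
have hb : `|expR (h * z b w) - 1 - h * z b w| <=
    h ^+ 2 * (cosh2 b w * (cosh2 b w * cosh2 b w)).
  apply: (le_trans (expR_second_order _)); rewrite exprMn -mulrA ler_wpM2l ?sqr_ge0 //.
  have -> : z b w ^+ 2 = `|z b w| * `|z b w| by rewrite -normrM -expr2 ger0_norm ?sqr_ge0.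
  rewrite mulrA; apply: ler_pM => //.
  - by apply: ler_pM => //; exact: normr_le_expR2.
  (* [exp u + exp (- u)] increases with [|u|], as [t + 1/t] does with [t >= 1] *)
  set u := z b w.
  have hu : `|h * u| <= `|u| by rewrite normrM ler_piMl.
  have aux (x y : R) : 0 <= x <= y -> expR x + expR (- x) <= expR y + expR (- y).
    move=> /andP[x0 xy].
    have ex : 1 <= expR x by rewrite -expR0 ler_expR.
    have exy : expR x <= expR y by rewrite ler_expR.
    rewrite !expRN.
    have -> : expR y + (expR y)^-1 = expR x + (expR x)^-1 +
       (expR y - expR x) * (1 - (expR x * expR y)^-1).
      by field; rewrite !gt_eqF ?expR_gt0.
    rewrite lerDl mulr_ge0 ?subr_ge0 // invf_le1 ?mulr_gt0 ?expR_gt0 //.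
    by apply: mulr_ege1 => //; apply: le_trans ex exy.
  have abs_cosh (x : R) : expR x + expR (- x) = expR `|x| + expR (- `|x|).
    by case: (ger0P x) => // _; rewrite opprK addrC.
  by rewrite /cosh2 -/u abs_cosh (abs_cosh u) aux // normr_ge0.
apply: le_trans (ler_pM _ _ (mono_bound s c w) hb) _ => //.
by rewrite le_eqVlt; apply/orP; left; apply/eqP; rewrite -/Q -/e; ring.
Qed.

(** Differentiation under the integral sign, in the form of a second-order
    bound: moving the exponent [c] in the direction [b] brings down a factor
    [z b]. *)
Lemma gaussian_monomial_expansion b s c : exists2 B : R, 0 <= B &
  forall h : R, `|h| <= 1 ->
  `|\int[P]_w ((\prod_(a <- s) z a w)
                * expR (\sum_a (c a + h * (a == b)%:R) * z a w))
    - \int[P]_w ((\prod_(a <- s) z a w) * expR (\sum_a c a * z a w))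
    - h * \int[P]_w ((\prod_(a <- b :: s) z a w) * expR (\sum_a c a * z a w))|
  <= h ^+ 2 * B.
Proof.
pose F := fun w => (\prod_(a <- [:: b, b, b & s]) cosh2 a w)
             * expR (\sum_a c a * z a w).
have iF : P.-integrable setT (EFin \o F) := dom_integrable _ _.
exists (\int[P]_w F w).
  by apply: Rintegral_ge0 => w _; rewrite mulr_ge0 ?expR_ge0 ?prodr_ge0.
move=> h h1.
rewrite -RintegralB //; try exact: gaussian_monomial_integrable.
rewrite -RintegralZl //; last exact: gaussian_monomial_integrable.
have i1 : P.-integrable setT (EFin \o ((fun w => ((\prod_(a <- s) z a w)
                * expR (\sum_a (c a + h * (a == b)%:R) * z a w))
    - ((\prod_(a <- s) z a w) * expR (\sum_a c a * z a w))))).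
  exact: (integrableB measurableT (gaussian_monomial_integrable _ _)
    (gaussian_monomial_integrable _ _)).
have i2 : P.-integrable setT (EFin \o ((fun w => h *
   ((\prod_(a <- b :: s) z a w) * expR (\sum_a c a * z a w))))).
  exact: (integrableZl measurableT h (gaussian_monomial_integrable _ _)).
rewrite -RintegralB // -RintegralZl //.
have i3 := integrableB measurableT i1 i2.
apply: le_trans (le_normr_Rintegral measurableT i3) _.
apply: le_Rintegral => //.
- exact: integrable_norm.
- exact: (integrableZl measurableT _ iF).
- by move=> w _; exact: expansion_bound.
Qed.

End GaussianSystem.

(** Induction on the monomial: an additional factor is a derivative of the
    generating function in the exponent, and functions of the exponent that
    agree have the same derivative. *)
Lemma gaussian_monomial_eq (R : realType) (K : finType)
    d (O : measurableType d) (P : probability O R) (z : K -> O -> R)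
    d' (O' : measurableType d') (P' : probability O' R) (z' : K -> O' -> R)
    (hz : gaussian_system P z) (hz' : gaussian_system P' z') s c :
  \int[P]_w ((\prod_(a <- s) z a w) * expR (\sum_a c a * z a w)) =
  \int[P']_w ((\prod_(a <- s) z' a w) * expR (\sum_a c a * z' a w)).
Proof.
elim: s c => [|b s IH] c.
  rewrite /Rintegral; congr fine.
  transitivity (\int[P]_w (expR (\sum_a c a * z a w))%:E)%E.
    by apply: eq_integral => w _; rewrite big_nil mul1r.
  rewrite hz.2 -(hz'.2 c).
  by apply: eq_integral => w _; rewrite big_nil mul1r.
have [B B0 hB] := gaussian_monomial_expansion hz b s c.
have [B' B0' hB'] := gaussian_monomial_expansion hz' b s c.
set I := LHS; set I' := RHS.
apply/eqP; rewrite -subr_eq0 -normr_le0; apply/ler_addgt0Pr => eps eps0.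
rewrite add0r.
pose h : R := Num.min 1 (eps / (B + B' + 1)).
have BB : 0 < B + B' + 1 by lra.
have h0 : 0 < h by rewrite lt_min ltr01 divr_gt0.
have h1 : `|h| <= 1 by rewrite gtr0_norm // ge_min lexx.
have := hB h h1; have := hB' h h1.
rewrite -!IH -/I -/I'; set u := (\int[P]__ _); set v := (\int[P]__ _).
move=> k1 k2; have : `|h * (I - I')| <= h ^+ 2 * (B + B').
  have -> : h * (I - I') = (u - v - h * I') - (u - v - h * I) by ring.
  by rewrite (le_trans (ler_normB _ _)) // mulrDr addrC lerD.
rewrite normrM (gtr0_norm h0) expr2 -mulrA ler_pM2l // => /le_trans; apply.
apply: (@le_trans _ _ (h * (B + B' + 1))).
  by rewrite ler_wpM2l ?(ltW h0) // lerDl.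
by rewrite -ler_pdivlMr // ge_min lexx orbT.
Qed.

Section PolyFun.
Context (R : realType) (K : finType).
Implicit Types G : (K -> R) -> R.

Definition poly_fun G : Prop := exists l : seq (R * seq K),
  forall v, G v = \sum_(p <- l) p.1 * \prod_(a <- p.2) v a.

Lemma poly_fun_cst c : poly_fun (fun=> c).
Proof. by exists [:: (c, [::])] => v; rewrite big_seq1 /= big_nil mulr1. Qed.

Lemma poly_fun_coord a : poly_fun (fun v => v a).
Proof. by exists [:: (1, [:: a])] => v; rewrite big_seq1 /= big_seq1 mul1r. Qed.

Lemma poly_funD G1 G2 : poly_fun G1 -> poly_fun G2 ->
  poly_fun (fun v => G1 v + G2 v).
Proof.
by move=> [l1 h1] [l2 h2]; exists (l1 ++ l2) => v; rewrite big_cat h1 h2.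
Qed.

Lemma poly_funM G1 G2 : poly_fun G1 -> poly_fun G2 ->
  poly_fun (fun v => G1 v * G2 v).
Proof.
move=> [l1 h1] [l2 h2].
exists [seq (p.1 * q.1, p.2 ++ q.2) | p <- l1, q <- l2] => v.
rewrite h1 h2 big_allpairs_dep big_distrl; apply: eq_bigr => p _.
rewrite big_distrr; apply: eq_bigr => q _ /=.
by rewrite big_cat /=; ring.
Qed.

Lemma poly_fun_sum (I : Type) (r : seq I) (G : I -> (K -> R) -> R) :
  (forall i, poly_fun (G i)) -> poly_fun (fun v => \sum_(i <- r) G i v).
Proof.
move=> hG; elim: r => [|i r IH].
  by have [l h] := poly_fun_cst 0; exists l => v; rewrite big_nil -h.
have [l h] := poly_funD (hG i) IH.
by exists l => v; rewrite big_cons h.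
Qed.

Lemma poly_fun_prod (I : Type) (r : seq I) (G : I -> (K -> R) -> R) :
  (forall i, poly_fun (G i)) -> poly_fun (fun v => \prod_(i <- r) G i v).
Proof.
move=> hG; elim: r => [|i r IH].
  by have [l h] := poly_fun_cst 1; exists l => v; rewrite big_nil -h.
have [l h] := poly_funM (hG i) IH.
by exists l => v; rewrite big_cons h.
Qed.

End PolyFun.

Section GaussianPoly.
Context (R : realType) (K : finType).

Lemma gaussian_monomial0_integrable d (O : measurableType d) (P : probability O R)
    (z : K -> O -> R) (hz : gaussian_system P z) (s : seq K) :
  P.-integrable setT (fun w => (\prod_(a <- s) z a w)%:E).
Proof.
have := gaussian_monomial_integrable hz s (fun=> 0).
apply: eq_integrable => // w _.
by rewrite (@big1 _ _ _ _ _ _ (fun a => 0 * z a w)) ?expR0 ?mulr1 // => a _;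
  rewrite mul0r.
Qed.

Lemma gaussian_monomial0_eq d (O : measurableType d) (P : probability O R)
    d' (O' : measurableType d') (P' : probability O' R)
    (z : K -> O -> R) (hz : gaussian_system P z)
    (z' : K -> O' -> R) (hz' : gaussian_system P' z') (s : seq K) :
  \int[P]_w (\prod_(a <- s) z a w) = \int[P']_w (\prod_(a <- s) z' a w).
Proof.
have := gaussian_monomial_eq hz hz' s (fun=> 0).
have e0 d0 (O0 : measurableType d0) (P0 : probability O0 R) (y : K -> O0 -> R) :
    \int[P0]_w ((\prod_(a <- s) y a w) * expR (\sum_a 0 * y a w)) =
    \int[P0]_w (\prod_(a <- s) y a w).
  apply: eq_Rintegral => w _.
  by rewrite (@big1 _ _ _ _ _ _ (fun a => 0 * y a w)) ?expR0 ?mulr1 // => a _; rewrite mul0r.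
by rewrite !e0.
Qed.

Lemma gaussian_poly_integrable d (O : measurableType d) (P : probability O R)
    (z : K -> O -> R) (hz : gaussian_system P z) G : poly_fun G ->
  P.-integrable setT (fun w => (G (fun a => z a w))%:E).
Proof.
move=> [l hG].
have : P.-integrable setT (fun w =>
    \sum_(p <- l) (p.1 * \prod_(a <- p.2) z a w)%:E)%E.
  apply: integrable_sum => // p _; rewrite ?inE.
  exact: (integrableZl measurableT p.1 (gaussian_monomial0_integrable hz _)).
by apply: eq_integrable => // w _; rewrite hG sumEFin.
Qed.

Lemma gaussian_poly_RintegralE d (O : measurableType d) (P : probability O R)
    (z : K -> O -> R) (hz : gaussian_system P z) (l : seq (R * seq K)) :
  \int[P]_w (\sum_(p <- l) p.1 * \prod_(a <- p.2) z a w) =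
  \sum_(p <- l) p.1 * \int[P]_w (\prod_(a <- p.2) z a w).
Proof.
elim: l => [|p l IH].
  by rewrite big_nil /Rintegral integral0_eq // => w _; rewrite big_nil.
rewrite big_cons -IH -RintegralZl //; last exact: gaussian_monomial0_integrable.
rewrite -RintegralD //.
- by apply: eq_Rintegral => w _; rewrite big_cons.
- exact: (integrableZl measurableT p.1 (gaussian_monomial0_integrable hz _)).
- by apply: (gaussian_poly_integrable hz (G := fun v => \sum_(p <- l) p.1 * \prod_(a <- p.2) v a)); exists l.
Qed.

Lemma gaussian_poly_eq d (O : measurableType d) (P : probability O R)
    d' (O' : measurableType d') (P' : probability O' R)
    (z : K -> O -> R) (hz : gaussian_system P z)
    (z' : K -> O' -> R) (hz' : gaussian_system P' z') G : poly_fun G ->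
  (\int[P]_w (G (fun a => z a w))%:E = \int[P']_w (G (fun a => z' a w))%:E)%E.
Proof.
move=> pG; have i1 := gaussian_poly_integrable hz pG.
have i2 := gaussian_poly_integrable hz' pG.
rewrite -[LHS]fineK ?integrable_fin_num // -[RHS]fineK ?integrable_fin_num //.
case: pG i1 i2 => l hG _ _; congr EFin.
transitivity (\int[P]_w (\sum_(p <- l) p.1 * \prod_(a <- p.2) z a w)).
  by apply: eq_Rintegral => w _.
rewrite gaussian_poly_RintegralE //.
under eq_bigr do rewrite (gaussian_monomial0_eq hz hz').
rewrite -gaussian_poly_RintegralE //.
by apply: eq_Rintegral => w _.
Qed.

Lemma gaussian_system_flip d (O : measurableType d) (P : probability O R)
    (z : K -> O -> R) (a : K) : gaussian_system P z ->
  gaussian_system P (fun b w => (if b == a then -1 else 1) * z b w).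
Proof.
move=> hz; split=> [b|c]; first by apply: measurable_funM => //; exact: hz.1.
have := hz.2 (fun b => c b * (if b == a then -1 else 1)).
under eq_integral do under eq_bigr do rewrite -mulrA.
move=> ->; congr (expR _)%:E; apply: eq_bigr => b _.
by congr (_ / _); case: eqP => _; rewrite ?mulr1 // mulrN1 sqrrN.
Qed.

End GaussianPoly.

Lemma gaussian_system_inj (R : realType) (K K' : finType) (f : K' -> K)
    d (O : measurableType d) (P : probability O R) (z : K -> O -> R) :
  injective f -> gaussian_system P z -> gaussian_system P (fun b => z (f b)).
Proof.
move=> finj hz; split=> [b|c]; first exact: hz.1.
pose c' a := \sum_(b | f b == a) c b.
have c'E b : c' (f b) = c b.
  rewrite /c' (eq_bigl (fun b' => b' == b)); last by move=> b'; rewrite inj_eq.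
  by rewrite big_pred1_eq.
have sumE (F : K -> R) : \sum_a c' a * F a = \sum_b c b * F (f b).
  rewrite [RHS](partition_big f xpredT) //=; apply: eq_bigr => a _.
  by rewrite big_distrl /=; apply: eq_bigr => b /eqP ->.
have := hz.2 c'.
under eq_integral do rewrite sumE.
move=> ->; congr (expR _)%:E; under eq_bigr do rewrite expr2 -mulrA.
by rewrite sumE; apply: eq_bigr => b _; rewrite c'E mulrA -expr2.
Qed.

(** * Multilinear forms in Gaussian variables *)

Section TensorForm.
Context (R : realType) (n N : nat).
Implicit Types (A : {ffun 'I_n -> 'I_N} -> R).

(** The tensor [A] evaluated on a vector [y] in the slots of [J], and on a vector
    [z (_, k)] proper to the slot in each other slot [k]. *)
Definition tensor_form (J : {set 'I_n}) A (y : 'I_N -> R) (z : 'I_N * 'I_n -> R) : R :=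
  \sum_(I : {ffun 'I_n -> 'I_N})
     A I * \prod_k (if k \in J then y (I k) else z (I k, k)).

Lemma tensor_form_setT A y z :
  tensor_form [set: 'I_n]%SET A y z = \sum_I A I * \prod_k y (I k).
Proof. by apply: eq_bigr => I _; congr (_ * _); apply: eq_bigr => k _; rewrite finset.in_setT. Qed.

Lemma tensor_form_poly J A y : poly_fun (fun z => tensor_form J A y z).
Proof.
apply: poly_fun_sum => I.
apply: (@poly_funM _ _ (fun=> A I)); first exact: poly_fun_cst.
apply: (@poly_fun_prod _ _ _ _ (fun k z => if k \in J then y (I k) else z (I k, k))).
by move=> k; case: (k \in J); [exact: poly_fun_cst|exact: poly_fun_coord].
Qed.

Lemma tensor_form_sqr_poly J A y : poly_fun (fun z => tensor_form J A y z ^+ 2).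
Proof. by apply: (poly_funM (tensor_form_poly _ _ _) (tensor_form_poly _ _ _)). Qed.

(** Distinct multi-indices give orthogonal monomials: changing the sign of a
    variable that occurs in only one of them changes the sign of the mean of
    their product.  All the squares have the same mean, because the slots keep
    the variables of a monomial distinct. *)
Lemma tensor_form0_sqr_integral A y
    d (O : measurableType d) (P : probability O R)
    (z : 'I_N * 'I_n -> O -> R) (hz : gaussian_system P z)
    d' (O' : measurableType d') (P' : probability O' R)
    (v : 'I_n -> O' -> R) (hv : gaussian_system P' v) :
  (\int[P]_w ((tensor_form finset.set0 A y (fun a => z a w)) ^+ 2)%:E =
   (\int[P']_w (\prod_k (v k w) ^+ 2))%:E * (\sum_I (A I) ^+ 2)%:E)%E.
Proof.
pose mono (I J : {ffun 'I_n -> 'I_N}) (x : 'I_N * 'I_n -> R) :=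
  (\prod_k x (I k, k)) * \prod_k x (J k, k).
have mono_poly I J : poly_fun (mono I J).
  by apply: poly_funM; apply: (@poly_fun_prod _ _ _ _ (fun k x => x (_ k, k))) => k;
    exact: poly_fun_coord.
have mono_int I J : P.-integrable setT (fun w => (mono I J (z^~ w))%:E).
  exact: gaussian_poly_integrable.
have mono0 I J : I != J -> (\int[P]_w (mono I J (z^~ w))%:E = 0)%E.
  move=> IJ; have [k Ik] : exists k, I k != J k.
    by apply/existsP; apply: contraNT IJ; rewrite negb_exists => /forallP h;
      apply/eqP/ffunP => k; have := h k; rewrite negbK => /eqP.
  have := gaussian_poly_eq hz (gaussian_system_flip (I k, k) hz) (mono_poly I J).
  set I1 := (\int[P]__ _)%E; set I2 := (\int[P]__ _)%E => E12.
  have : (I2 = - I1)%E.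
    rewrite /I2 /I1 -[RHS]mulN1e -(integralZl measurableT (mono_int I J) (- 1)).
    apply: eq_integral => w _; rewrite -EFinM mulN1r; congr EFin; rewrite /mono.
    rewrite (bigD1 k) //= eqxx.
    rewrite (eq_bigr (fun l => z (I l, l) w)); last first.
      move=> l lk /=; suff -> : ((I l, l) == (I k, k)) = false by rewrite mul1r.
      apply/negP => /eqP[_ kl].
      by rewrite kl eqxx in lk.
    rewrite [X in _ * X = _](eq_bigr (fun l => z (J l, l) w)); last first.
      move=> l _ /=; suff -> : ((J l, l) == (I k, k)) = false by rewrite mul1r.
      apply/negP => /eqP[JI lk].
      by move: Ik; rewrite -lk JI lk eqxx.
    by rewrite [in RHS](bigD1 k) //= mulN1r !mulNr.
  rewrite -E12; have : I1 \is a fin_num by exact: integrable_fin_num.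
  case: (I1) => [r| |] //= _ [] /eqP.
  by rewrite -addr_eq0 -mulr2n mulrn_eq0 /= => /eqP ->.
have mono1 I : (\int[P]_w (mono I I (z^~ w))%:E =
    (\int[P']_w (\prod_k (v k w) ^+ 2))%:E)%E.
  have hI : gaussian_system P (fun k => z (I k, k)).
    by apply: (gaussian_system_inj (f := fun k => (I k, k))) => // k l [].
  have pG : poly_fun (fun x : 'I_n -> R => \prod_k x k ^+ 2).
    apply: (@poly_fun_prod _ _ _ _ (fun k x => x k ^+ 2)) => k.
    by apply: poly_funM; exact: poly_fun_coord.
  rewrite [RHS]fineK; last by apply: integrable_fin_num => //; exact: (gaussian_poly_integrable hv pG).
  rewrite -(gaussian_poly_eq hI hv pG); apply: eq_integral => w _.
  by rewrite /mono -big_split.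
transitivity (\int[P]_w (\sum_I \sum_J (A I * A J)%:E * (mono I J (z^~ w))%:E))%E.
  apply: eq_integral => w _.
  under eq_bigr do under eq_bigr do rewrite -EFinM.
  under eq_bigr do rewrite sumEFin.
  rewrite sumEFin; congr EFin.
  rewrite expr2 /tensor_form big_distrl; apply: eq_bigr => I _.
  rewrite big_distrr; apply: eq_bigr => J _ /=.
  rewrite /mono.
  rewrite (eq_bigr (fun k => z (I k, k) w)); last by move=> k _; rewrite finset.in_set0.
  rewrite [X in _ * (_ * X) = _](eq_bigr (fun k => z (J k, k) w)); last by move=> k _; rewrite finset.in_set0.
  by ring.
rewrite integral_sum //; last first.
  by move=> I; apply: integrable_sum => // J _; exact: integrableZl.
rewrite -sumEFin ge0_sume_distrr; last by move=> I _; rewrite lee_fin sqr_ge0.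
apply: eq_bigr => I _; rewrite integral_sum //; last by move=> J; exact: integrableZl.
rewrite (bigD1 I) //= big1 ?adde0; last first.
  by move=> J JI; rewrite integralZl // mono0 ?mule0 // eq_sym.
by rewrite integralZl // mono1 muleC expr2.
Qed.

Lemma tensor_form_eq_out (K : {set 'I_n}) (A : {ffun 'I_n -> 'I_N} -> R) y z z' :
  (forall a, a.2 \notin K -> z a = z' a) ->
  tensor_form K A y z = tensor_form K A y z'.
Proof.
move=> zz; apply: eq_bigr => I _; congr (_ * _); apply: eq_bigr => k _.
by case: ifPn => // kK; exact: zz.
Qed.

Lemma measurable_tensor_form d (S : measurableType d) (K : {set 'I_n})
    (A : {ffun 'I_n -> 'I_N} -> R) (y : 'I_N -> S -> R)
    (z : 'I_N * 'I_n -> S -> R) :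
  (forall i, measurable_fun setT (y i)) -> (forall a, measurable_fun setT (z a)) ->
  measurable_fun setT (fun s => tensor_form K A (y^~ s) (z^~ s)).
Proof.
move=> my mz; apply: measurable_sum => I; apply: measurable_funM => //.
apply: measurable_prod => k _.
by case: (k \in K).
Qed.

End TensorForm.

(** * Reflection of a shifted Gaussian vector *)

Section Reflection.
Context (R : realType) (n N : nat) (J : {set 'I_n}).

Definition slot_index (a : 'I_N * 'I_n) : nat := pickle a.

Definition reflection_coef : R := 2 / (1 + #|J|%:R).

(** The images of the vectors [x' (slot_index (_, l))], one for each slot [l],
    under the orthogonal reflection of the family formed by [x] and by these
    vectors that reverses the sum of [x] and of the vectors of the slots in [J].
    The images in the slots of [J] contain a multiple of [x]; the other vectors
    are unchanged. *)
Definition reflected (x x' : nat -> R) (a : 'I_N * 'I_n) : R :=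
  x' (slot_index a) - reflection_coef * (a.2 \in J)%:R *
    (x a.1 + \sum_(l in J) x' (slot_index (a.1, l))).

Lemma slot_index_inj : injective slot_index.
Proof. exact: (pcan_inj pickleK). Qed.

Lemma reflection_coef_gt0 : 0 < reflection_coef.
Proof. by rewrite divr_gt0 // ltr_wpDr. Qed.

Lemma reflected_shift x x' y a :
  reflected (fun i => x i + y i) x' a =
  - (reflection_coef * (a.2 \in J)%:R) * y a.1 + reflected x x' a.
Proof. by rewrite /reflected; ring. Qed.

Lemma reflected_out x x' a : a.2 \notin J -> reflected x x' a = x' (slot_index a).
Proof. by move=> /negbTE aJ; rewrite /reflected aJ mulr0 mul0r subr0. Qed.

Lemma measurable_reflected d (S : measurableType d)
    (x x' : nat -> S -> R) (a : 'I_N * 'I_n) :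
  (forall i, measurable_fun setT (x i)) -> (forall i, measurable_fun setT (x' i)) ->
  measurable_fun setT (fun s => reflected (x^~ s) (x'^~ s) a).
Proof.
move=> mx mx'; apply: measurable_funB => //; apply: measurable_funM => //.
apply: measurable_funD => //.
under eq_fun do rewrite -big_enum /=.
exact: measurable_sum.
Qed.

End Reflection.

Section ShiftExpansion.
Context (R : realType) (n : nat).

Definition subset_coef (lam : R) (J K : {set 'I_n}) : R :=
  \prod_(k in K) (- (lam * (k \in J)%:R)).

(** Multilinear expansion over the set [K] of the slots in which the shift is
    chosen.  Only the slots of [J] are shifted, so that the coefficient of [K]
    vanishes unless [K] is contained in [J]. *)
Lemma tensor_form_shift (N : nat) (J : {set 'I_n}) (A : {ffun 'I_n -> 'I_N} -> R)
    (x y x' : nat -> R) y0 :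
  tensor_form finset.set0 A y0 (reflected J (fun i => x i + y i) x') =
  \sum_(K : {set 'I_n}) subset_coef (reflection_coef R J) J K *
     tensor_form K A (fun i => y i) (reflected J x x').
Proof.
under [RHS]eq_bigr do rewrite big_distrr /=.
rewrite exchange_big; apply: eq_bigr => I _ /=.
under [RHS]eq_bigr do rewrite mulrCA.
rewrite -big_distrr; congr (_ * _) => /=.
rewrite (eq_bigr (fun k => - (reflection_coef R J * (k \in J)%:R) * y (I k)
    + reflected J x x' (I k, k))); last first.
  by move=> k _; rewrite finset.in_set0 reflected_shift.
rewrite bigA_distr; apply: eq_bigr => K _.
rewrite /subset_coef [X in _ = X * _]big_mkcond -big_split /=; apply: eq_bigr => k _.
by case: ifP => _; rewrite ?mul1r.
Qed.

Lemma subset_coef_notsub lam (J K : {set 'I_n}) :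
  ~~ (K \subset J) -> subset_coef lam J K = 0.
Proof.
move=> /subsetPn[k kK kJ]; rewrite /subset_coef (bigD1 k) //= (negbTE kJ).
by rewrite mulr0 oppr0 mul0r.
Qed.

Lemma subset_coef_id lam (J : {set 'I_n}) :
  lam != 0 -> subset_coef lam J J != 0.
Proof.
move=> lam0; apply/prodf_neq0 => k kJ.
by rewrite kJ mulr1 oppr_eq0.
Qed.

End ShiftExpansion.

(** * The standard Gaussian of a Hilbert space *)

Lemma normal_mgf (R : realType) (s : R) : s != 0 ->
  (\int[normal_prob 0 s]_x (expR x)%:E = (expR (s ^+ 2 / 2))%:E)%E.
Proof.
move=> s0; rewrite (integral_density (integrable_normal_pdf 0 s)) //; last first.
  exact/measurable_EFinP.
(* completing the square *)
rewrite (_ : (fun x => _) = fun x =>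
    (expR (s ^+ 2 / 2))%:E * (normal_pdf (s ^+ 2) s x)%:E)%E; last first.
  apply/funext => x; rewrite -!EFinM; congr EFin.
  rewrite !normal_pdfE // /normal_fun mulrCA [RHS]mulrCA -!expRD.
  by congr (_ * expR _); field.
by rewrite integralZl ?integral_normal_pdf ?mule1 //; exact: integrable_normal_pdf.
Qed.

Section GeneralizedFunction.
Context (R : realType) (H : completeNormedModType R)
    (d : measure_display) (T : measurableType d) (mu : probability T R)
    (Y : H -> L0 mu).

Lemma L0_measurable (f : L0 mu) : measurable_fun setT (f : T -> R).
Proof. exact: (measurable_funPT (repr f)). Qed.

Hypothesis hY : generalized_function Y.

Lemma generalized_function_sum (I : Type) (r : seq I) (c : I -> R) (v : I -> H) :
  {ae mu, forall t, Y (\sum_(i <- r) c i *: v i) t = \sum_(i <- r) c i * Y (v i) t}.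
Proof.
elim: r => [|i r IH].
  apply: filterS (hY.1 1 0 0) => t; rewrite !big_nil scaler0 addr0 mul1r => h.
  by apply: (@addrI _ (Y 0 t)); rewrite addr0 -h.
apply: filterS2 IH (hY.1 (c i) (v i) (\sum_(j <- r) c j *: v j)) => t IH.
by rewrite !big_cons IH.
Qed.

End GeneralizedFunction.

Section GaussianFamily.
Context (R : realType) (H : completeNormedModType R)
    (ip : {dot H for @idfun R}) (e : nat -> H)
    (d : measure_display) (Omega : measurableType d) (P : probability Omega R)
    (X : H -> L0 P).
Hypotheses (hip : dot_induces_norm ip) (he : orthonormal_basis ip e)
  (hX : standard_gaussian X).

Lemma gaussian_mgf (xi : H) :
  (\int[P]_w (expR (X xi w))%:E = (expR (`|xi| ^+ 2 / 2))%:E)%E.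
Proof.
have mX : measurable_fun setT (X xi : Omega -> measurableTypeR R) := L0_measurable _.
have mexp : measurable_fun [set: measurableTypeR R] (fun x => (expR x)%:E).
  exact/measurable_EFinP.
transitivity (\int[pushforward P (X xi : Omega -> measurableTypeR R)]_x (expR x)%:E)%E.
  rewrite ge0_integral_pushforward // => x _; exact: expR_ge0.
have [x0|x0] := eqVneq `|xi| 0.
  rewrite (@eq_measure_integral _ _ _ _ \d_(0 : measurableTypeR R)).
    by rewrite integral_dirac // diracT mul1e x0 expr0n mul0r.
  by move=> A mA _; apply: etrans (hX.2 xi A mA) _;
    rewrite /centered_gaussian x0 eqxx.
rewrite -normal_mgf //; apply: eq_measure_integral => A mA _.
by apply: etrans (hX.2 xi A mA) _; rewrite /centered_gaussian (negbTE x0).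
Qed.

Lemma orthonormal_sum_norm (K : finType) (phi : K -> nat) (c : K -> R) :
  injective phi -> `|\sum_a c a *: e (phi a)| ^+ 2 = \sum_a (c a) ^+ 2.
Proof.
move=> phi_inj; rewrite -hip linear_sumlz; apply: eq_bigr => a _.
rewrite linearZl_LR linear_sumr (bigD1 a) //= big1 ?addr0; last first.
  move=> b ba; rewrite linearZr_LR /= he.1 inj_eq // eq_sym (negbTE ba).
  by rewrite mulr0.
by rewrite linearZr_LR /= he.1 eqxx mulr1 expr2.
Qed.

Lemma gaussian_coordinates_system (K : finType) (phi : K -> nat) : injective phi ->
  gaussian_system P (fun a => X (e (phi a))).
Proof.
move=> phi_inj; split=> [a|c]; first exact: L0_measurable.
rewrite -mulr_suml -(orthonormal_sum_norm c phi_inj) -gaussian_mgf.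
apply: ae_eq_integral => //.
- apply/measurable_EFinP; apply: measurableT_comp => //.
  apply: measurable_sum => a; apply: measurable_funM => //; exact: L0_measurable.
- by apply/measurable_EFinP; apply: measurableT_comp => //; exact: L0_measurable.
- have := generalized_function_sum hX.1 (index_enum K) c (fun a => e (phi a)).
  by apply: filterS => w h _ /=; rewrite h.
Qed.

(** Orthogonal transformations preserve the Gaussian law. *)
Lemma reflected_gaussian_system (n N : nat) (J : {set 'I_n}) :
  gaussian_system (P \x P)%E (fun (a : 'I_N * 'I_n) (w : Omega * Omega) =>
    reflected J (fun i => X (e i) w.1) (fun i => X (e i) w.2) a).
Proof.
have mX1 i : measurable_fun setT (fun w : Omega * Omega => X (e i) w.1).
  exact: (measurableT_comp (L0_measurable _) measurable_fst).
have mX2 i : measurable_fun setT (fun w : Omega * Omega => X (e i) w.2).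
  exact: (measurableT_comp (L0_measurable _) measurable_snd).
split=> [a|c].
  exact: (@measurable_reflected _ _ _ J _ _
    (fun i (w : Omega * Omega) => X (e i) w.1) (fun i w => X (e i) w.2)).
pose lam := reflection_coef R J.
have pairE (F : 'I_N * 'I_n -> R) : \sum_a F a = \sum_i \sum_k F (i, k).
  by rewrite pair_bigA; apply: eq_bigr => -[].
have sumJ (F : 'I_n -> R) : \sum_k (k \in J)%:R * F k = \sum_(k in J) F k.
  rewrite [RHS]big_mkcond; apply: eq_bigr => k _.
  by case: (k \in J); rewrite ?mul1r ?mul0r.
(* the reflection being symmetric, it acts on the coefficients [c], extended by
   zero to the coordinates of [x], as it acts on the vectors *)
pose D i := \sum_(l in J) c (i, l).
pose al i := - lam * D i.
pose be (a : 'I_N * 'I_n) := c a - (a.2 \in J)%:R * lam * D a.1.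
have linE x x' : \sum_a c a * reflected J x x' a =
    \sum_i al i * x (nat_of_ord i) + \sum_a be a * x' (slot_index a).
  rewrite /be /al; under [X in _ = _ + X]eq_bigr do rewrite mulrBl.
  rewrite big_split /= addrCA.
  transitivity (\sum_a c a * x' (slot_index a)
    - lam * \sum_a c a * (a.2 \in J)%:R *
       (x a.1 + \sum_(l in J) x' (slot_index (a.1, l)))).
    rewrite mulr_sumr -sumrB; apply: eq_bigr => a _.
    by rewrite /reflected -/lam; ring.
  congr (_ + _).
  rewrite !pairE mulr_sumr -sumrN -big_split /=; apply: eq_bigr => i _.
  rewrite [X in _ = _ + X](eq_bigr (fun k =>
      - (lam * D i) * ((k \in J)%:R * x' (slot_index (i, k))))); last first.
    by move=> k _ /=; ring.
  rewrite -mulr_sumr -mulr_suml.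
  have -> : \sum_k c (i, k) * (k \in J)%:R = D i.
    by rewrite -[RHS]sumJ; apply: eq_bigr => k _; rewrite mulrC.
  by rewrite sumJ; ring.
have normE : \sum_a (c a) ^+ 2 / 2 =
    \sum_i (al i) ^+ 2 / 2 + \sum_a (be a) ^+ 2 / 2.
  rewrite -!mulr_suml -mulrDl; congr (_ / _).
  rewrite !pairE -big_split /=; apply: eq_bigr => i _.
  have expand m : \sum_k (c (i, k) - (k \in J)%:R * m) ^+ 2 =
      \sum_k c (i, k) ^+ 2 + (- m *+ 2) * D i + m ^+ 2 * #|J|%:R.
    rewrite -[D i]sumJ -sum1_card natr_sum.
    rewrite -[X in _ + _ * X](sumJ (fun=> 1)) !mulr_sumr -!big_split /=.
    by apply: eq_bigr => k _; case: (k \in J) => /=; ring.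
  have -> : \sum_k be (i, k) ^+ 2 = \sum_k c (i, k) ^+ 2
      + (- (lam * D i) *+ 2) * D i + (lam * D i) ^+ 2 * #|J|%:R.
    by rewrite -(expand (lam * D i)); apply: eq_bigr => k _; rewrite /be /= -mulrA.
  have lamE : lam * (1 + #|J|%:R) = 2.
    by rewrite /lam /reflection_coef divfK // gt_eqF // ltr_wpDr.
  rewrite -[LHS]addr0 /al [RHS](_ : _ = \sum_k c (i, k) ^+ 2 +
    D i ^+ 2 * lam * (lam * (1 + #|J|%:R) - 2)); last by ring.
  by rewrite lamE subrr mulr0.
under eq_integral do rewrite linE expRD EFinM.
have h1 := gaussian_coordinates_system (@ord_inj N).
have h2 := gaussian_coordinates_system (@slot_index_inj n N).
rewrite fubini_tonelli1 /=; last 2 first.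
- apply: emeasurable_funM; apply/measurable_EFinP.
    apply: measurableT_comp => //.
    by apply: measurable_sum => i; apply: measurable_funM.
  apply: measurableT_comp => //.
  by apply: measurable_sum => i; apply: measurable_funM.
- by move=> w; rewrite -EFinM lee_fin mulr_ge0 ?expR_ge0.
rewrite /fubini_F /=.
have mexp2 : measurable_fun setT (fun w : Omega =>
    (expR (\sum_a be a * X (e (slot_index a)) w))%:E).
  apply/measurable_EFinP; apply: measurableT_comp => //.
  by apply: measurable_sum => i; apply: measurable_funM => //; exact: L0_measurable.
under eq_integral do rewrite ge0_integralZl ?lee_fin ?expR_ge0 // h2.2.
rewrite ge0_integralZr //; last first.
  apply/measurable_EFinP; apply: measurableT_comp => //.
  apply: measurable_sum => i; apply: measurable_funM => //; exact: L0_measurable.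
by rewrite h1.2 -EFinM -expRD normE.
Qed.

End GaussianFamily.

(** * The weight given by absolute continuity *)

Section Rinfty.
Context (R : realType).

Lemma measurable_coord (i : nat) :
  measurable_fun [set: Rinfty R] (fun x : Rinfty R => (x : nat -> R) i).
Proof.
move=> _ B mB; rewrite setTI; apply: sub_sigma_algebra.
by exists i, B.
Qed.

Lemma measurable_to_Rinfty d (T : measurableType d) (f : T -> Rinfty R) :
  (forall i, measurable_fun setT (fun t => (f t : nat -> R) i)) ->
  measurable_fun setT f.
Proof.
move=> mf; apply: (@measurability _ _ T (Rinfty R) setT f (@cylinders R)) => //.
move=> _ [_ [i [B [mB ->]]] <-].
by have := mf i measurableT B mB; rewrite setTI.
Qed.

End Rinfty.

(** With [D] the density of the law of [f] with respect to the law of [g], the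
    weight [w := exp (- D)] satisfies [w D <= 1]. *)
Lemma dominated_weight (R : realType) (d d' : measure_display)
    (S : measurableType d) (S' : measurableType d')
    (Q : probability S R) (P : probability S' R)
    (d0 : measure_display) (E : measurableType d0) (f : S -> E) (g : S' -> E) :
  measurable_fun setT f -> measurable_fun setT g ->
  pushforward Q f `<< pushforward P g ->
  exists w : E -> R, [/\ measurable_fun setT w, (forall x, 0 < w x <= 1) &
    forall h : E -> R, measurable_fun setT h -> (forall x, 0 <= h x) ->
      (\int[Q]_z (w (f z) * h (f z))%:E <= \int[P]_z (h (g z))%:E)%E].
Proof.
move=> mf mg fg.
pose f' : {RV Q >-> E} := HB.pack f (isMeasurableFun.Build _ _ _ _ f mf).
pose g' : {RV P >-> E} := HB.pack g (isMeasurableFun.Build _ _ _ _ g mg).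
pose nu := distribution Q f'; pose la := distribution P g'.
have numu : nu `<< la by [].
pose D := Radon_Nikodym_SigmaFinite.f nu la.
have D0 x : (0 <= D x)%E by exact: Radon_Nikodym_SigmaFinite.f_ge0.
have Dfin x : D x \is a fin_num by exact: Radon_Nikodym_SigmaFinite.f_fin_num.
have mD : measurable_fun setT D.
  by apply: measurable_int; exact: Radon_Nikodym_SigmaFinite.f_integrable.
pose r x := fine (D x).
have r0 x : 0 <= r x by rewrite fine_ge0.
have mr : measurable_fun setT r by exact: measurableT_comp.
pose w x := expR (- r x).
have w01 x : 0 < w x <= 1.
  by rewrite expR_gt0 /= -expR0 ler_expR oppr_le0.
have mw : measurable_fun setT w.
  by apply: measurableT_comp => //; exact: measurableT_comp.
exists w; split => // h mh h0.
have w0 x : 0 <= w x by have /andP[/ltW] := w01 x.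
have mwh : measurable_fun setT (fun x => (w x * h x)%:E).
  by apply/measurable_EFinP; exact: measurable_funM.
have -> : (\int[Q]_z (w (f z) * h (f z))%:E = \int[nu]_x (w x * h x)%:E)%E.
  by rewrite ge0_integral_pushforward // => x _; rewrite lee_fin mulr_ge0.
have -> : (\int[P]_z (h (g z))%:E = \int[la]_x (h x)%:E)%E.
  rewrite ge0_integral_pushforward //; first exact/measurable_EFinP.
  by move=> x _; rewrite lee_fin.
rewrite -(Radon_Nikodym_SigmaFinite.change_of_variables numu) //; last first.
  by move=> x; rewrite lee_fin mulr_ge0.
apply: ge0_le_integral => //.
- by move=> x _; rewrite mule_ge0 // lee_fin mulr_ge0.
- exact: emeasurable_funM.
- exact/measurable_EFinP.
move=> x _; rewrite -/(D x) -[D x]fineK // -/(r x) -EFinM lee_fin.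
rewrite mulrAC ler_piMl // /w expRN mulrC ler_pdivrMr ?expR_gt0 // mul1r.
by rewrite (le_trans _ (expR_ge1Dx _)) // lerDr.
Qed.

(** * The weighted tensor inequality *)

Lemma sqr_sum_le (R : realType) (I : finType) (a : I -> R) :
  (\sum_i a i) ^+ 2 <= #|I|%:R * \sum_i (a i) ^+ 2.
Proof.
have -> : #|I|%:R * \sum_i (a i) ^+ 2 =
    \sum_i \sum_j (a i ^+ 2 + a j ^+ 2) / 2.
  under [RHS]eq_bigr do rewrite -mulr_suml big_split /= sumr_const.
  rewrite -mulr_suml big_split /= sumr_const sumrMnl -mulr_natl.
  by field.
rewrite expr2 big_distrl; apply: ler_sum => i _.
rewrite big_distrr; apply: ler_sum => j _ /=.
have : 0 <= (a i - a j) ^+ 2 by rewrite sqr_ge0.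
by rewrite !expr2; lra.
Qed.

Section WeightedTensorBound.
Context (R : realType) (H : completeNormedModType R)
    (ip : {dot H for @idfun R}) (e : nat -> H)
    (d1 : measure_display) (Omega : measurableType d1) (P : probability Omega R)
    (d2 : measure_display) (T : measurableType d2) (mu : probability T R)
    (X : H -> L0 P) (Y : H -> L0 mu).
Hypotheses (hip : dot_induces_norm ip) (he : orthonormal_basis ip e)
    (hX : standard_gaussian X).
Local Notation x i := (L0_fun (X (e i))).
Local Notation y i := (L0_fun (Y (e i))).

(** [W] stands for [w (X + Y)], with [w] the weight of [dominated_weight]. *)
Variable W : Omega * T -> R.
Hypotheses (mW : measurable_fun setT W) (W01 : forall z, 0 < W z <= 1)
  (hW : forall h : Rinfty R -> R, measurable_fun setT h -> (forall v, 0 <= h v) ->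
    (\int[P \x mu]_z (W z * h (fun i => x i z.1 + y i z.2)%R)%:E
      <= \int[P]_w (h (fun i => x i w))%:E)%E).

Let W0 z : 0 <= W z. Proof. by have /andP[/ltW] := W01 z. Qed.
Let W1 z : W z <= 1. Proof. by have /andP[_] := W01 z. Qed.

Let mx i : measurable_fun setT (x i). Proof. exact: L0_measurable. Qed.
Let my i : measurable_fun setT (y i). Proof. exact: L0_measurable. Qed.

Definition section_mean (t : T) : R := fine (\int[P]_w (W (w, t))%:E)%E.

Let mWs t : measurable_fun setT (fun w => (W (w, t))%:E).
Proof. by apply/measurable_EFinP; exact: measurableT_comp. Qed.

Let int_W_ge0 t : (0 <= \int[P]_w (W (w, t))%:E)%E.
Proof. by apply: integral_ge0 => w _; rewrite lee_fin. Qed.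

Let int_W_le1 t : (\int[P]_w (W (w, t))%:E <= 1)%E.
Proof.
rewrite -(probability_setT P) -[leRHS]mul1e -integral_cst //.
by apply: ge0_le_integral => // w _; rewrite lee_fin.
Qed.

Lemma section_meanE t : (section_mean t)%:E = (\int[P]_w (W (w, t))%:E)%E.
Proof. by rewrite fineK // ge0_fin_numE // (le_lt_trans (int_W_le1 t)) // ltry. Qed.

Lemma section_mean_le1 t : section_mean t <= 1.
Proof. by rewrite -lee_fin section_meanE. Qed.

Lemma section_mean_gt0 t : 0 < section_mean t.
Proof.
rewrite -lte_fin section_meanE lt_neqAle int_W_ge0 andbT eq_sym; apply/negP => /eqP W0t.
have : ae_eq P setT (fun w => (W (w, t))%:E) (cst 0%E).
  apply/ae_eq_integral_abs => //.
  by under eq_integral do rewrite gee0_abs ?lee_fin //.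
rewrite /ae_eq => h.
have : P setT = 0%E.
  apply: measure_negligible => //; apply: negligibleS h => w _ /= /(_ I) [] W0w.
  by have := W01 (w, t); rewrite W0w ltxx.
by rewrite probability_setT => /eqP; rewrite onee_eq0.
Qed.

Lemma measurable_section_mean : measurable_fun setT section_mean.
Proof.
apply: measurableT_comp => //.
apply: (measurable_fun_fubini_tonelli_G (fun z => (W z)%:E)) => //.
exact/measurable_EFinP.
Qed.

Local Notation rho := section_mean.

Variable n : nat.

(** The weights with which the proper subsets of [J] enter the induction step. *)
Definition lower_coef (J K : {set 'I_n}) : R :=
  if K == J then 0 else subset_coef (reflection_coef R J) J K ^+ 2.

Lemma lower_coef_ge0 J K : 0 <= lower_coef J K.
Proof. by rewrite /lower_coef; case: ifP => // _; exact: sqr_ge0. Qed.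

Lemma lower_coef_proper (J K : {set 'I_n}) : ~~ (K \proper J) -> lower_coef J K = 0.
Proof.
rewrite /lower_coef finset.properEneq negb_and negbK.
by case: eqVneq => //= _ /subset_coef_notsub ->; rewrite expr0n.
Qed.

Section Form.
Variables (N : nat) (A : {ffun 'I_n -> 'I_N} -> R).

Definition partial_form_sqr (K : {set 'I_n}) (t : T) (w : Omega) : R :=
  tensor_form K A (fun i => y i t) (fun a => x (slot_index a) w) ^+ 2.

Lemma partial_form_sqr_ge0 K t w : 0 <= partial_form_sqr K t w.
Proof. exact: sqr_ge0. Qed.

(** The Gaussian slots are averaged out, so that a function of the parameter
    [t] remains; the induction concerns these functions. *)
Definition mean_form (K : {set 'I_n}) (t : T) : \bar R :=
  (\int[P]_w (partial_form_sqr K t w)%:E)%E.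

Lemma measurable_partial_form_sqr K :
  measurable_fun setT (fun z : T * Omega => partial_form_sqr K z.1 z.2).
Proof.
apply: measurable_funX.
apply: (@measurable_tensor_form _ _ _ _ _ K A
  (fun i (z : T * Omega) => y i z.1)
  (fun a (z : T * Omega) => x (slot_index a) z.2)) => [i|a].
  exact: (measurableT_comp (my _) measurable_fst).
exact: (measurableT_comp (mx _) measurable_snd).
Qed.

Lemma mean_form_ge0 K t : (0 <= mean_form K t)%E.
Proof. by apply: integral_ge0 => w _; rewrite lee_fin sqr_ge0. Qed.

Lemma measurable_mean_form K : measurable_fun setT (mean_form K).
Proof.
apply: (measurable_fun_fubini_tonelli_F
  (fun z : T * Omega => (partial_form_sqr K z.1 z.2)%:E)) => //.
  by apply/measurable_EFinP; exact: measurable_partial_form_sqr.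
by move=> z; rewrite lee_fin sqr_ge0.
Qed.

(** Both families of Gaussian variables have the same joint moments. *)
Lemma mean_form_reflected (J K : {set 'I_n}) t :
  (\int[P \x P]_w (tensor_form K A (fun i => y i t)
     (reflected J (fun i => x i w.1) (fun i => x i w.2)) ^+ 2)%:E
   = mean_form K t)%E.
Proof.
exact: (gaussian_poly_eq (reflected_gaussian_system hip he hX N J)
  (gaussian_coordinates_system hip he hX (@slot_index_inj n N))
  (tensor_form_sqr_poly K A (fun i => y i t))).
Qed.

Section Step.
Variable J : {set 'I_n}.
Local Notation lam := (reflection_coef R J).
Local Notation z w := (reflected J (fun i => x i w.1) (fun i => x i w.2)).

Definition shifted_form_sqr (w w' : Omega) (t : T) : R :=
  tensor_form finset.set0 A (fun=> 0)
    (reflected J (fun i => x i w + y i t) (fun i => x i w')) ^+ 2.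

Let unshifted_form_sqr (w : Omega * Omega) : R :=
  tensor_form finset.set0 A (fun=> 0) (z w) ^+ 2.

Let measurable_shifted d (S : measurableType d) (u v : S -> Omega) (r : S -> T) :
  measurable_fun setT u -> measurable_fun setT v -> measurable_fun setT r ->
  measurable_fun setT
    (fun s => (W (u s, r s) * shifted_form_sqr (u s) (v s) (r s))%:E).
Proof.
move=> hu hv hr; apply/measurable_EFinP; apply: measurable_funM.
  by apply: measurableT_comp => //; exact: measurable_fun_pair.
apply: measurable_funX.
apply: (@measurable_tensor_form _ _ _ _ _ _ A (fun i (s : S) => 0) (fun a s =>
  reflected J (fun i => x i (u s) + y i (r s)) (fun i => x i (v s)) a)) => // a.
apply: (@measurable_reflected _ _ _ J _ _ (fun i s => x i (u s) + y i (r s))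
  (fun i s => x i (v s))) => i.
  apply: measurable_funD.
    exact: (measurableT_comp (mx _) hu).
  exact: (measurableT_comp (my _) hr).
exact: (measurableT_comp (mx _) hv).
Qed.

Let measurable_reflected_sqr K (y0 : 'I_N -> R) : measurable_fun setT
  (fun w => (tensor_form K A y0 (z w) ^+ 2)%:E).
Proof.
apply/measurable_EFinP; apply: measurable_funX.
apply: (@measurable_tensor_form _ _ _ _ _ _ A
  (fun i (w : Omega * Omega) => y0 i) (fun a w => z w a)) => // a.
apply: (@measurable_reflected _ _ _ J _ _
  (fun i (w : Omega * Omega) => x i w.1) (fun i w => x i w.2)) => i.
  exact: (measurableT_comp (mx _) measurable_fst).
exact: (measurableT_comp (mx _) measurable_snd).
Qed.

Let measurable_unshifted :
  measurable_fun setT (fun w => (unshifted_form_sqr w)%:E) :=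
  measurable_reflected_sqr finset.set0 (fun=> 0).

(** The term of [J] in the expansion of [tensor_form_shift], isolated. *)
Lemma step_pointwise w w' t :
  (subset_coef lam J J) ^+ 2 * partial_form_sqr J t w' <=
  #|{set 'I_n}|%:R * (shifted_form_sqr w w' t + \sum_(K : {set 'I_n})
    lower_coef J K * tensor_form K A (fun i => y i t) (z (w, w')) ^+ 2).
Proof.
pose b K := if K == J then tensor_form finset.set0 A (fun=> 0)
    (reflected J (fun i => x i w + y i t) (fun i => x i w'))
  else - (subset_coef lam J K * tensor_form K A (fun i => y i t) (z (w, w'))).
have -> : subset_coef lam J J ^+ 2 * partial_form_sqr J t w' = (\sum_K b K) ^+ 2.
  rewrite /partial_form_sqr -exprMn; congr (_ ^+ 2).
  rewrite (bigD1 J) //= /b eqxx.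
  rewrite [X in _ = X + _](tensor_form_shift J A (fun i => x i w)
    (fun i => y i t) (fun i => x i w') (fun=> 0)).
  rewrite (bigD1 J) //= -addrA -big_split /= big1 ?addr0; last first.
    by move=> K /negbTE ->; rewrite subrr.
  congr (_ * _); apply: tensor_form_eq_out => a aJ.
  by rewrite reflected_out.
apply: le_trans (sqr_sum_le _) _.
rewrite ler_wpM2l // (bigD1 J) //= {1}/b eqxx lerD2l.
rewrite [leRHS](bigD1 J) //= {1}/lower_coef eqxx mul0r add0r.
apply: ler_sum => K /negbTE KJ.
by rewrite /b /lower_coef KJ sqrrN exprMn.
Qed.

(** The density inequality, applied for each value of the adjoined Gaussian
    vectors to the whole form as a function of [X + Y]. *)
Lemma shifted_mean_le :
  (\int[mu]_t \int[P \x P]_w (W (w.1, t) * shifted_form_sqr w.1 w.2 t)%:E <=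
   \int[P \x P]_w (unshifted_form_sqr w)%:E)%E.
Proof.
have pos w w' t : (0 <= (W (w, t) * shifted_form_sqr w w' t)%:E)%E.
  by rewrite lee_fin mulr_ge0 // sqr_ge0.
pose F (q : (Omega * T) * Omega) :=
  ((W (q.1.1, q.1.2) * shifted_form_sqr q.1.1 q.2 q.1.2)%:E)%E.
have mF : measurable_fun setT F.
  by apply: measurable_shifted; do ?exact: measurableT_comp.
have F0 q : (0 <= F q)%E by exact: pos.
rewrite (_ : (\int[mu]_t _)%E =
    (\int[mu]_t \int[P]_w \int[P]_w' F ((w, t), w'))%E); last first.
  apply: eq_integral => t _.
  rewrite (fubini_tonelli1 (fun w => (W (w.1, t) * shifted_form_sqr w.1 w.2 t)%:E)) //.
  exact: measurable_shifted.
rewrite -(fubini_tonelli2 (fun q : Omega * T => (\int[P]_w' F (q, w'))%E)) /=; last 2 first.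
- exact: (measurable_fun_fubini_tonelli_F F).
- by move=> q; apply: integral_ge0.
pose PT : probability (Omega * T)%type R := (P \x mu)%E.
rewrite (@fubini_tonelli _ _ _ _ R PT P F mF F0).
rewrite (fubini_tonelli2 (fun w => (unshifted_form_sqr w)%:E)) //; last first.
  by move=> q; rewrite lee_fin sqr_ge0.
apply: ge0_le_integral => //.
- by move=> w' _; apply: integral_ge0.
- exact: (measurable_fun_fubini_tonelli_G F).
- apply: (measurable_fun_fubini_tonelli_G (fun w => (unshifted_form_sqr w)%:E)) => //.
  by move=> q; rewrite lee_fin sqr_ge0.
move=> w' _; rewrite /fubini_G /=.
pose h (v : Rinfty R) := tensor_form finset.set0 A (fun=> 0)
   (reflected J (v : nat -> R) (fun i => x i w')) ^+ 2.
have mh : measurable_fun setT h.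
  apply: measurable_funX.
  apply: (@measurable_tensor_form _ _ _ _ _ _ A (fun i (v : Rinfty R) => 0)
    (fun a v => reflected J (v : nat -> R) (fun i => x i w') a)) => // a.
  apply: (@measurable_reflected _ _ _ J _ _
    (fun i (v : Rinfty R) => (v : nat -> R) i) (fun i v => x i w')) => i //.
  exact: measurable_coord.
have h0 v : 0 <= h v by exact: sqr_ge0.
apply: le_trans (hW mh h0).
by rewrite le_eqVlt; apply/orP; left; apply/eqP; apply: eq_integral => -[w t] _.
Qed.

Local Notation shifted_mean t :=
  (\int[P \x P]_w (W (w.1, t) * shifted_form_sqr w.1 w.2 t)%:E)%E.

Let shifted_ge0 w w' t : 0 <= W (w, t) * shifted_form_sqr w w' t.
Proof. by rewrite mulr_ge0 // sqr_ge0. Qed.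

(** The Gaussian slots of the term of [J] depend on the second sample point only,
    so that the weight integrates to [rho] separately. *)
Lemma step_mean t :
  ((subset_coef lam J J ^+ 2)%:E * ((rho t)%:E * mean_form J t) <=
   #|{set 'I_n}|%:R%:E * (shifted_mean t +
     \sum_(K : {set 'I_n}) (lower_coef J K)%:E * mean_form K t))%E.
Proof.
have mp : measurable_fun setT (fun w => (partial_form_sqr J t w)%:E).
  apply/measurable_EFinP; apply: measurable_funX.
  exact: (@measurable_tensor_form _ _ _ _ _ J A
    (fun i w => y i t) (fun a w => x (slot_index a) w)).
have p0 w : (0 <= (partial_form_sqr J t w)%:E)%E by rewrite lee_fin sqr_ge0.
have q0 w : 0 <= subset_coef lam J J ^+ 2 * partial_form_sqr J t w.
  by rewrite mulr_ge0 ?sqr_ge0.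
have lhsE : ((subset_coef lam J J ^+ 2)%:E * ((rho t)%:E * mean_form J t) =
    \int[P \x P]_w (W (w.1, t) *
      (subset_coef lam J J ^+ 2 * partial_form_sqr J t w.2))%:E)%E.
  rewrite fubini_tonelli1 /=; last 2 first.
  - apply/measurable_EFinP; apply: measurable_funM.
      by apply: measurableT_comp => //; exact: measurable_fun_pair.
    apply: measurable_funM => //.
    by have /measurable_EFinP/measurableT_comp := mp; apply.
  - by move=> w; rewrite lee_fin mulr_ge0.
  rewrite /fubini_F /=.
  have inner w : (\int[P]_w' (W (w, t) *
      (subset_coef lam J J ^+ 2 * partial_form_sqr J t w'))%:E =
      (W (w, t))%:E * ((subset_coef lam J J ^+ 2)%:E * mean_form J t))%E.
    have mcp : measurable_fun setT (fun w' =>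
        (subset_coef lam J J ^+ 2 * partial_form_sqr J t w')%:E).
      by apply/measurable_EFinP; apply: measurable_funM => //; exact/measurable_EFinP.
    under eq_integral do rewrite EFinM.
    rewrite ge0_integralZl ?lee_fin //; last by move=> w' _; rewrite lee_fin.
    congr (_ * _)%E; under eq_integral do rewrite EFinM.
    by rewrite ge0_integralZl ?lee_fin ?sqr_ge0.
  under eq_integral do rewrite inner.
  rewrite ge0_integralZr //; last 2 first.
  - by move=> w _; rewrite lee_fin.
  - by rewrite mule_ge0 ?lee_fin ?sqr_ge0 ?mean_form_ge0.
  by rewrite -section_meanE muleCA.
rewrite lhsE.
have mT : measurable_fun setT (fun w => (W (w.1, t) * shifted_form_sqr w.1 w.2 t)%:E).
  exact: measurable_shifted.
have -> : (\sum_(K : {set 'I_n}) (lower_coef J K)%:E * mean_form K t =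
    \int[P \x P]_w \sum_(K : {set 'I_n})
      (lower_coef J K)%:E * (tensor_form K A (fun i => y i t) (z w) ^+ 2)%:E)%E.
  rewrite ge0_integral_sum //.
  - apply: eq_bigr => K _; rewrite ge0_integralZl ?lee_fin ?lower_coef_ge0 //.
      by rewrite mean_form_reflected.
    by move=> w _; rewrite lee_fin sqr_ge0.
  - by move=> K; exact: emeasurable_funM.
  - by move=> K w _; rewrite mule_ge0 ?lee_fin ?lower_coef_ge0 ?sqr_ge0.
have mS : measurable_fun setT (fun w => (\sum_(K : {set 'I_n})
    (lower_coef J K)%:E * (tensor_form K A (fun i => y i t) (z w) ^+ 2)%:E)%E).
  by apply: emeasurable_sum => K; exact: emeasurable_funM.
have S0 w : (0 <= \sum_(K : {set 'I_n})
    (lower_coef J K)%:E * (tensor_form K A (fun i => y i t) (z w) ^+ 2)%:E)%E.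
  by apply: sume_ge0 => K _; rewrite mule_ge0 ?lee_fin ?lower_coef_ge0 ?sqr_ge0.
rewrite -ge0_integralD //; last by move=> w _; rewrite lee_fin.
rewrite -ge0_integralZl ?lee_fin //; last 2 first.
- exact: emeasurable_funD.
- by move=> w _; rewrite adde_ge0 // lee_fin.
apply: ge0_le_integral => //.
- by move=> w _; rewrite lee_fin mulr_ge0.
- apply/measurable_EFinP; apply: measurable_funM.
    by apply: measurableT_comp => //; exact: measurable_fun_pair.
  apply: measurable_funM => //.
  by have /measurable_EFinP/measurableT_comp := mp; apply.
- by apply: emeasurable_funM => //; exact: emeasurable_funD.
move=> -[w w'] _ /=.
under eq_bigr do rewrite -EFinM.
rewrite sumEFin -EFinD -EFinM lee_fin.
apply: (le_trans (ler_wpM2l (W0 _) (step_pointwise w w' t))).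
rewrite mulrCA ler_wpM2l // mulrDr lerD2l.
rewrite ler_piMl //; apply: sumr_ge0 => K _.
by rewrite mulr_ge0 ?lower_coef_ge0 ?sqr_ge0.
Qed.

Let mrho m : measurable_fun setT (fun t => (rho t ^+ m)%:E).
Proof. by apply/measurable_EFinP; apply: measurable_funX; exact: measurable_section_mean. Qed.

Let rho0 m t : 0 <= rho t ^+ m.
Proof. by rewrite exprn_ge0 // ltW // section_mean_gt0. Qed.

(** [step_mean] integrated against [rho^m]: the left-hand side gains a factor
    [rho], and the whole form needs no such factor since [rho <= 1]. *)
Lemma step_integral m :
  ((subset_coef lam J J ^+ 2)%:E * \int[mu]_t ((rho t ^+ m.+1)%:E * mean_form J t) <=
   #|{set 'I_n}|%:R%:E * (\int[P \x P]_w (unshifted_form_sqr w)%:E +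
     \sum_(K : {set 'I_n}) (lower_coef J K)%:E *
       \int[mu]_t ((rho t ^+ m)%:E * mean_form K t)))%E.
Proof.
have mm K := measurable_mean_form K.
have m0 K t := mean_form_ge0 K t.
have msh : measurable_fun setT (fun t => shifted_mean t).
  pose PP : probability (Omega * Omega)%type R := (P \x P)%E.
  apply: (@measurable_fun_fubini_tonelli_F _ _ _ _ _ PP (fun q : T * (Omega * Omega) =>
    (W (q.2.1, q.1) * shifted_form_sqr q.2.1 q.2.2 q.1)%:E)%E).
  - apply: measurable_shifted => //.
      exact: (measurableT_comp measurable_fst measurable_snd).
    exact: (measurableT_comp measurable_snd measurable_snd).
  - by move=> q; rewrite lee_fin.
have sh0 t : (0 <= shifted_mean t)%E.
  by apply: integral_ge0 => w _; rewrite lee_fin.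
apply: (@le_trans _ _ (#|{set 'I_n}|%:R%:E * (\int[mu]_t shifted_mean t +
     \sum_(K : {set 'I_n}) (lower_coef J K)%:E *
       \int[mu]_t ((rho t ^+ m)%:E * mean_form K t)))%E); last first.
  by rewrite lee_wpmul2l ?lee_fin // leeD2r // shifted_mean_le.
have mterm K : measurable_fun setT (fun t =>
   ((lower_coef J K)%:E * ((rho t ^+ m)%:E * mean_form K t))%E).
  by do 2 apply: emeasurable_funM => //.
have term0 K t : (0 <= (lower_coef J K)%:E * ((rho t ^+ m)%:E * mean_form K t))%E.
  by rewrite !mule_ge0 ?lee_fin ?lower_coef_ge0.
have -> : (\sum_(K : {set 'I_n}) (lower_coef J K)%:E *
       \int[mu]_t ((rho t ^+ m)%:E * mean_form K t) =
    \int[mu]_t \sum_(K : {set 'I_n}) (lower_coef J K)%:E *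
       ((rho t ^+ m)%:E * mean_form K t))%E.
  rewrite ge0_integral_sum //; apply: eq_bigr => K _.
  rewrite ge0_integralZl ?lee_fin ?lower_coef_ge0 //; first exact: emeasurable_funM.
  by move=> t _; rewrite mule_ge0 ?lee_fin.
have msum : measurable_fun setT (fun t => (\sum_(K : {set 'I_n})
    (lower_coef J K)%:E * ((rho t ^+ m)%:E * mean_form K t))%E).
  exact: emeasurable_sum.
have sum0 t : (0 <= \sum_(K : {set 'I_n})
    (lower_coef J K)%:E * ((rho t ^+ m)%:E * mean_form K t))%E.
  exact: sume_ge0.
have mlhs : measurable_fun setT (fun t => ((rho t ^+ m.+1)%:E * mean_form J t)%E).
  exact: emeasurable_funM.
have mrhs := emeasurable_funD msh msum.
rewrite -ge0_integralD // -ge0_integralZl ?lee_fin ?sqr_ge0 //; last first.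
  by move=> t _; rewrite mule_ge0 ?lee_fin.
rewrite -ge0_integralZl ?lee_fin //; last by move=> t _; rewrite adde_ge0.
apply: ge0_le_integral => //.
- by move=> t _; rewrite mule_ge0 ?lee_fin ?sqr_ge0 // mule_ge0 ?lee_fin.
- exact: emeasurable_funM.
- exact: emeasurable_funM.
move=> t _ /=.
rewrite [rho t ^+ _]exprSr (EFinM (rho t ^+ m) (rho t)) -muleA.
rewrite (muleCA (subset_coef lam J J ^+ 2)%:E).
have rm0 : (0 <= (rho t ^+ m)%:E)%E by rewrite lee_fin.
apply: (le_trans (lee_wpmul2l rm0 (step_mean t))).
rewrite muleCA lee_wpmul2l ?lee_fin // ge0_muleDr //; last first.
  by apply: sume_ge0 => K _; rewrite mule_ge0 ?lee_fin ?lower_coef_ge0.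
apply: leeD.
  by rewrite gee_pMl // ?lee_fin ?exprn_ile1 // ?section_mean_le1 // ltW // section_mean_gt0.
rewrite ge0_sume_distrr; last by move=> K _; rewrite mule_ge0 ?lee_fin ?lower_coef_ge0.
by apply: lee_sum => K _; rewrite muleCA.
Qed.

End Step.
End Form.

(** Strong induction on [#|J|], with [step_integral] as its step.  Uniformity in
    [N] and [A] is what carries the bound over to infinite dimension. *)
Lemma weighted_mean_form_bound (J : {set 'I_n}) : exists2 C : R, 0 <= C &
  forall N (A : {ffun 'I_n -> 'I_N} -> R),
  (\int[mu]_t ((rho t ^+ #|J|)%:E * mean_form A J t)
    <= (C * \sum_I (A I) ^+ 2)%:E)%E.
Proof.
have hv := gaussian_coordinates_system hip he hX (@ord_inj n).
pose kappa := (\int[P]_w (\prod_(k < n) (x k w) ^+ 2)).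
have kappa0 : 0 <= kappa.
  by apply: Rintegral_ge0 => w _; apply: prodr_ge0 => k _; exact: sqr_ge0.
have S0 N (A : {ffun 'I_n -> 'I_N} -> R) : 0 <= \sum_I (A I) ^+ 2.
  by apply: sumr_ge0 => I _; exact: sqr_ge0.
have [m] := ubnP #|J|; elim: m J => // m IH J; rewrite ltnS => Jm.
have [J0|[k0 k0J]] := finset.set_0Vmem J.
  exists kappa => // N A; rewrite J0 finset.cards0.
  under eq_integral do rewrite expr0 mul1e /mean_form /partial_form_sqr
    (tensor_form0_sqr_integral _ _ (gaussian_coordinates_system hip he hX (@slot_index_inj n N)) hv).
  by rewrite integral_cst // [X in (_ * X)%E]probability_setT mule1 EFinM.
have [m' Jm'] : exists m', #|J| = m'.+1.
  by exists #|J|.-1; rewrite prednK //; apply/card_gt0P; exists k0.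
have /choice[f hf] : forall K : {set 'I_n}, exists C : R, 0 <= C /\ (K \proper J ->
    forall N (A : {ffun 'I_n -> 'I_N} -> R),
      (\int[mu]_t ((rho t ^+ #|K|)%:E * mean_form A K t)
        <= (C * \sum_I (A I) ^+ 2)%:E)%E).
  move=> K; have [KJ|KJ] := boolP (K \proper J); last by exists 0.
  have [|C C0 hC] := IH K; last by exists C.
  exact: leq_trans (proper_card KJ) Jm.
set cJ := subset_coef (reflection_coef R J) J J ^+ 2.
have cJ0 : 0 < cJ.
  by rewrite exprn_even_gt0 //= subset_coef_id // gt_eqF // reflection_coef_gt0.
pose M := #|{set 'I_n}|%:R : R.
pose B := M * (kappa + \sum_(K : {set 'I_n}) lower_coef J K * f K).
have B0 : 0 <= B.
  rewrite mulr_ge0 // addr_ge0 // sumr_ge0 // => K _.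
  by rewrite mulr_ge0 ?lower_coef_ge0 //; have [] := hf K.
exists (cJ^-1 * B); first by rewrite mulr_ge0 // invr_ge0 ltW.
move=> N A; set S := \sum_I _.
rewrite -mulrA EFinM -[leLHS]mul1e -(mulVf (lt0r_neq0 cJ0)) EFinM -muleA.
refine (@lee_wpmul2l R (cJ^-1)%:E _ _ _ _).
  by rewrite lee_fin invr_ge0 ltW.
rewrite Jm'; apply: le_trans (step_integral A J m') _.
rewrite (tensor_form0_sqr_integral _ _ (reflected_gaussian_system hip he hX N J) hv).
rewrite -/kappa -/S -EFinM /B -mulrA (EFinM M).
refine (@lee_wpmul2l R M%:E _ _ _ _); first by rewrite lee_fin.
rewrite mulrDl EFinD leeD2l // mulr_suml -sumEFin; apply: lee_sum => K _.
have [KJ|KJ] := boolP (K \proper J); last first.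
  by rewrite lower_coef_proper // mul0e !mul0r.
rewrite -mulrA EFinM; refine (@lee_wpmul2l R (lower_coef J K)%:E _ _ _ _).
  by rewrite lee_fin lower_coef_ge0.
apply: le_trans ((hf K).2 KJ N A).
have mp j : measurable_fun setT (fun t => ((rho t ^+ j)%:E * mean_form A K t)%E).
  apply: emeasurable_funM; last exact: measurable_mean_form.
  by apply/measurable_EFinP; apply: measurable_funX; exact: measurable_section_mean.
apply: ge0_le_integral => //.
  move=> t _; rewrite mule_ge0 ?mean_form_ge0 // lee_fin exprn_ge0 // ltW //.
  exact: section_mean_gt0.
move=> t _; rewrite lee_wpmul2r ?mean_form_ge0 // lee_fin.
rewrite ler_wiXn2l // ?section_mean_le1 // ?(ltW (section_mean_gt0 t)) //.
by rewrite -ltnS -Jm' proper_card.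
Qed.

Lemma weighted_tensor_bound : exists2 C : R, 0 <= C &
  forall N (A : {ffun 'I_n -> 'I_N} -> R),
  (\int[mu]_t (rho t ^+ n * (\sum_I A I * \prod_k y (I k) t) ^+ 2)%:E
    <= (C * \sum_I (A I) ^+ 2)%:E)%E.
Proof.
have [C C0 hC] := weighted_mean_form_bound [set: 'I_n]%SET.
exists C => // N A; apply: le_trans (hC N A).
have mean_formT t : mean_form A [set: 'I_n]%SET t =
    ((\sum_I A I * \prod_k y (I k) t) ^+ 2)%:E.
  rewrite /mean_form /partial_form_sqr.
  under eq_integral do rewrite tensor_form_setT.
  by rewrite integral_cst // [X in (_ * X)%E]probability_setT mule1.
rewrite finset.cardsT card_ord.
by under [leRHS]eq_integral do rewrite mean_formT -EFinM.
Qed.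

End WeightedTensorBound.

(** * Moments of the shift under the equivalent measure *)

Lemma cvg_big_prod (R : realType) (K : Type) (r : seq K) (f : K -> nat -> R) (l : K -> R) :
  (forall k, f k @ \oo --> l k) ->
  (\prod_(k <- r) f k N) @[N --> \oo] --> \prod_(k <- r) l k.
Proof.
move=> fl; elim: r => [|k r IH].
  rewrite big_nil; under eq_fun do rewrite big_nil.
  exact: cvg_cst.
rewrite big_cons; under eq_fun do rewrite big_cons.
exact: cvgM.
Qed.

Section HilbertSchmidt.
Context (R : realType) (H : completeNormedModType R)
    (ip : {dot H for @idfun R}) (e : nat -> H)
    (d : measure_display) (T : measurableType d) (mu nu : probability T R)
    (Y : H -> L0 mu).
Hypotheses (hip : dot_induces_norm ip) (he : orthonormal_basis ip e)
  (hY : generalized_function Y) (numu : nu `<< mu).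
Local Notation y i := (L0_fun (Y (e i))).
Variables (n : nat) (C : R).
Hypotheses (C0 : 0 <= C)
  (hC : forall N (A : {ffun 'I_n -> 'I_N} -> R),
  (\int[nu]_t ((\sum_I A I * \prod_k y (I k) t) ^+ 2)%:E
    <= (C * \sum_I (A I) ^+ 2)%:E)%E).

Let my i : measurable_fun setT (y i). Proof. exact: L0_measurable. Qed.

Let mmono (N : nat) (A : {ffun 'I_n -> 'I_N} -> R) :
  measurable_fun setT (fun t => \sum_I A I * \prod_k y (I k) t).
Proof.
apply: measurable_sum => I; apply: measurable_funM => //.
by apply: measurable_prod => k _.
Qed.

Section Truncation.
Variable xi : 'I_n -> H.
Local Notation coef k i := (ip (xi k) (e i)).

Definition truncated_product (N : nat) (t : T) : R :=
  \prod_k \sum_(i < N) coef k i * y i t.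

Definition truncated_norm (N : nat) : R := \prod_k \sum_(i < N) (coef k i) ^+ 2.

Definition limit_product (t : T) : R := \prod_k Y (xi k) t.

Definition limit_norm : R := \prod_k `|xi k| ^+ 2.

Lemma truncated_productE N t : truncated_product N t =
  \sum_(I : {ffun 'I_n -> 'I_N}) (\prod_k coef k (I k)) * \prod_k y (I k) t.
Proof.
rewrite /truncated_product bigA_distr_bigA; apply: eq_bigr => I _.
by rewrite big_split.
Qed.

Lemma truncated_sqr_norm_cvg k :
  (\sum_(i < N) (coef k i) ^+ 2) @[N --> \oo] --> `|xi k| ^+ 2.
Proof.
have -> : (fun N => \sum_(i < N) (coef k i) ^+ 2) =
    (fun N => `|series (fun i => coef k i *: e i) N| ^+ 2).
  apply/funext => N; rewrite seriesEord.
  by rewrite -(orthonormal_sum_norm hip he (fun i : 'I_N => coef k i) (@ord_inj N)).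
apply: (cvg_comp _ (fun u : R => u ^+ 2)); last exact: exprn_continuous.
by apply: cvg_norm; exact: he.2.
Qed.

Lemma truncated_norm_cvg : truncated_norm @ \oo --> limit_norm.
Proof. by apply: cvg_big_prod => k; exact: truncated_sqr_norm_cvg. Qed.

Lemma truncated_norm_le N M : (N <= M)%N -> truncated_norm N <= truncated_norm M.
Proof.
move=> NM; apply: ler_prod => k _; apply/andP; split.
  by apply: sumr_ge0 => i _; exact: sqr_ge0.
rewrite (big_ord_widen _ (fun i => coef k i ^+ 2) NM) big_mkcond /=.
by apply: ler_sum => i _; case: ifP => // _; exact: sqr_ge0.
Qed.

Lemma truncated_norm_le_limit N : truncated_norm N <= limit_norm.
Proof.
have h := truncated_norm_cvg; rewrite -(cvg_lim _ h) //.
apply: nondecreasing_cvgn_le; last by apply/cvg_ex; exists limit_norm.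
by move=> *; exact: truncated_norm_le.
Qed.

(** The difference of two truncations is the value of [Y] on the tensor whose
    coordinates are those of the larger truncation outside of the smaller
    cube. *)
Lemma truncated_product_cauchy N M : (N <= M)%N ->
  (\int[nu]_t ((truncated_product M t - truncated_product N t) ^+ 2)%:E
     <= (C * (truncated_norm M - truncated_norm N))%:E)%E.
Proof.
move=> NM.
pose c' k (i : 'I_M) : R := if (i < N)%N then coef k i else 0.
have c'E k (g : nat -> R) : \sum_(i < N) coef k i * g i = \sum_(i < M) c' k i * g i.
  rewrite (big_ord_widen _ (fun i => coef k i * g i) NM) big_mkcond.
  by apply: eq_bigr => i _; rewrite /c'; case: ifP => // _; rewrite mul0r.
pose A (I : {ffun 'I_n -> 'I_M}) := \prod_k coef k (I k) - \prod_k c' k (I k).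
have -> : (fun t => ((truncated_product M t - truncated_product N t) ^+ 2)%:E) =
    (fun t => ((\sum_I A I * \prod_k y (I k) t) ^+ 2)%:E).
  apply/funext => t; congr (_ ^+ 2)%:E; rewrite truncated_productE.
  have -> : truncated_product N t = \prod_k \sum_(i < M) c' k i * y i t.
    by apply: eq_bigr => k _; rewrite (c'E k (fun i => y i t)).
  rewrite bigA_distr_bigA -sumrB; apply: eq_bigr => I _.
  by rewrite big_split /= /A mulrBl.
apply: le_trans (hC A) _; rewrite lee_fin ler_wpM2l //.
have -> : truncated_norm N = \prod_k \sum_(i < M) (c' k i) ^+ 2.
  apply: eq_bigr => k _; rewrite (c'E k (fun i => coef k i)).
  apply: eq_bigr => i _; rewrite /c'; case: ifP => // _.
  by rewrite mul0r expr0n.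
rewrite /truncated_norm !bigA_distr_bigA -sumrB; apply: ler_sum => I _.
rewrite !prodrXl /A; have [h|] := boolP [forall k, (I k < N)%N].
  rewrite le_eqVlt; apply/orP; left; apply/eqP.
  have -> : \prod_k c' k (I k) = \prod_k coef k (I k).
    by apply: eq_bigr => k _; rewrite /c' (forallP h k).
  by rewrite !subrr expr0n.
rewrite negb_forall => /existsP[k Ik].
have -> : \prod_k c' k (I k) = 0.
  by rewrite (bigD1 k) //= {1}/c' (negbTE Ik) mul0r.
by rewrite expr0n !subr0.
Qed.

Lemma truncated_product_sqr N :
  (\int[nu]_t ((truncated_product N t) ^+ 2)%:E <= (C * truncated_norm N)%:E)%E.
Proof.
under eq_integral do rewrite truncated_productE.
apply: le_trans (hC _) _; rewrite lee_fin ler_wpM2l //.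
rewrite /truncated_norm bigA_distr_bigA le_eqVlt; apply/orP; left; apply/eqP.
by apply: eq_bigr => I _; rewrite prodrXl.
Qed.

Lemma measurable_truncated_product N : measurable_fun setT (truncated_product N).
Proof.
apply: measurable_prod => k _; apply: measurable_sum => i.
exact: measurable_funM.
Qed.

Lemma measurable_limit_product : measurable_fun setT limit_product.
Proof. by apply: measurable_prod => k _; exact: L0_measurable. Qed.

(** The truncation of [Y (xi k)] is [Y] of a partial sum of the expansion of
    [xi k], up to a null set that serves all truncations. *)
Lemma truncated_product_subseq : exists phi : nat -> nat, (forall j, (j <= phi j)%N) /\
  {ae nu, forall t, truncated_product (phi j) t @[j --> \oo] --> limit_product t}.
Proof.
pose x k N := series (fun i => coef k i *: e i) N.
have [|||phi [phij hphi]] := @cvg_measure_subseq_ae R _ _ mu 'I_n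
  (fun k N => Y (x k N)) (fun k => Y (xi k)).
- by move=> k j; exact: L0_measurable.
- by move=> k; exact: L0_measurable.
- move=> k eps eps0.
  exact: (cvg_comp _ _ (he.2 (xi k)) (hY.2 (xi k) eps eps0)).
exists phi; split => //.
apply: (ae_dominates numu).
have trunc_ae : {ae mu, forall t, forall N, forall k,
    Y (x k N) t = \sum_(i < N) coef k i * y i t}.
  apply: ae_foralln => N; apply: filter_forall => k.
  have := generalized_function_sum hY (index_enum 'I_N) (fun i => coef k i) (fun i => e i).
  by rewrite /x seriesEord.
apply: filterS2 trunc_ae hphi => t htr hcv.
apply: cvg_big_prod => k.
by under eq_fun do rewrite -htr; exact: hcv.
Qed.

(** The Cauchy bound passes to an almost sure limit along a subsequence. *)
Lemma limit_product_dist N :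
  (\int[nu]_t ((limit_product t - truncated_product N t) ^+ 2)%:E
     <= (C * (limit_norm - truncated_norm N))%:E)%E.
Proof.
have [phi [phij hphi]] := truncated_product_subseq.
have mZ := measurable_truncated_product; have mL := measurable_limit_product.
apply: (@fatou_ae _ _ _ nu (fun j t =>
  (truncated_product (phi (maxn N j)) t - truncated_product N t) ^+ 2)).
- by move=> j; apply: measurable_funX; exact: measurable_funB.
- by apply: measurable_funX; exact: measurable_funB.
- by move=> j t; exact: sqr_ge0.
- by move=> t; exact: sqr_ge0.
- apply: filterS hphi => t ht.
  apply: (cvg_comp _ (fun u : R => u ^+ 2)); last exact: exprn_continuous.
  apply: cvgB; last exact: cvg_cst.
  apply: (cvg_comp (fun j => maxn N j) (fun j => truncated_product (phi j) t)); last exact: ht.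
  by apply/cvgnyPge => M; near=> j; rewrite leq_max; apply/orP; right; near: j; exact: nbhs_infty_ge.
move=> j.
have Nphi : (N <= phi (maxn N j))%N by rewrite (leq_trans _ (phij _)) // leq_maxl.
apply: le_trans (truncated_product_cauchy Nphi) _.
by rewrite lee_fin ler_wpM2l // lerD2r truncated_norm_le_limit.
Unshelve. all: by end_near.
Qed.

Lemma limit_product_sqr :
  (\int[nu]_t (limit_product t ^+ 2)%:E <= (C * limit_norm)%:E)%E.
Proof.
have [phi [phij hphi]] := truncated_product_subseq.
apply: (@fatou_ae _ _ _ nu (fun j t => truncated_product (phi j) t ^+ 2)).
- by move=> j; apply: measurable_funX; exact: measurable_truncated_product.
- by apply: measurable_funX; exact: measurable_limit_product.
- by move=> j t; exact: sqr_ge0.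
- by move=> t; exact: sqr_ge0.
- apply: filterS hphi => t ht.
  by apply: (cvg_comp _ (fun u : R => u ^+ 2) ht); exact: exprn_continuous.
move=> j; apply: le_trans (truncated_product_sqr _) _.
by rewrite lee_fin ler_wpM2l // truncated_norm_le_limit.
Qed.

Lemma truncated_product_mean_cvg :
  (\int[nu]_t truncated_product N t) @[N --> \oo] --> \int[nu]_t limit_product t.
Proof.
have mZ := measurable_truncated_product; have mL := measurable_limit_product.
apply/cvgrPdist_le => eps eps0.
have gap_cvg : (C * (limit_norm - truncated_norm N)) @[N --> \oo] --> (0 : R).
  rewrite -(mulr0 C) -(subrr limit_norm); apply: cvgM; first exact: cvg_cst.
  by apply: cvgB; [exact: cvg_cst|exact: truncated_norm_cvg].
apply: filterS (cvgr0_norm_le _ gap_cvg _ (exprn_gt0 2 eps0)) => N hN.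
have [_ /(_ eps eps0)] := sqr_integrable_bound (measurable_funB mL (mZ N)) (limit_product_dist N).
rewrite RintegralB //; last 2 first.
- exact: (sqr_integrable_bound mL limit_product_sqr).1.
- exact: (sqr_integrable_bound (mZ N) (truncated_product_sqr N)).1.
move=> /le_trans; apply.
have : eps^-1 * (C * (limit_norm - truncated_norm N)) <= eps.
  rewrite mulrC ler_pdivrMr // -expr2; apply: le_trans hN; exact: ler_norm.
lra.
Qed.

End Truncation.

Lemma monomial_integrable (N : nat) (I : 'I_n -> 'I_N) :
  nu.-integrable setT (EFin \o (fun t => \prod_k y (I k) t)).
Proof.
have mI : measurable_fun setT (fun t => \prod_k y (I k) t).
  by apply: measurable_prod => k _.
have := hC (fun J => (J == finfun I)%:R).
have E t : \sum_(J : {ffun 'I_n -> 'I_N}) (J == finfun I)%:R * \prod_k y (J k) t =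
    \prod_k y (I k) t.
  rewrite (bigD1 (finfun I)) //= eqxx mul1r.
  rewrite [X in _ + X]big1 ?addr0; last first.
    by move=> J /negbTE ->; rewrite mul0r.
  by apply: eq_bigr => k _; rewrite ffunE.
under eq_integral do rewrite E.
by move=> h; have [] := sqr_integrable_bound mI h.
Qed.

Definition moment (i : 'I_n -> nat) : R := \int[nu]_t \prod_k y (i k) t.

Lemma moment_sum N (A : {ffun 'I_n -> 'I_N} -> R) :
  \int[nu]_t (\sum_I A I * \prod_k y (I k) t) =
  \sum_I A I * moment (fun k => I k).
Proof.
have int_term I : nu.-integrable setT (fun t => (A I * \prod_k y (I k) t)%:E).
  exact: (integrableZl measurableT (A I) (monomial_integrable I)).
rewrite /Rintegral; under eq_integral do rewrite -sumEFin.
rewrite integral_sum //.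
have E I : (\int[nu]_t (A I * \prod_k y (I k) t)%:E)%E =
    (A I * moment (fun k => I k))%:E.
  rewrite -RintegralZl //; last exact: monomial_integrable.
  by rewrite fineK //; exact: integrable_fin_num.
by under eq_bigr do rewrite E; rewrite sumEFin.
Qed.

(** The array [A] of moments is tested on itself: its square sum [s] is the mean
    of [<Y^(x n), A>], hence at most the square root of [C s]. *)
Lemma moment_sqr_sum N :
  \sum_(I : {ffun 'I_n -> 'I_N}) moment (fun k => I k) ^+ 2 <= C + 1.
Proof.
pose A (I : {ffun 'I_n -> 'I_N}) := moment (fun k => I k).
(* [C + 1] rather than [C], which may be zero *)
have [_ /(_ (C + 1))] := sqr_integrable_bound (mmono A) (hC A).
rewrite moment_sum; have C1 : 0 < C + 1 by rewrite ltr_wpDl.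
have -> : \sum_I A I * moment (fun k => I k) = \sum_I A I ^+ 2.
  by apply: eq_bigr => I _; rewrite expr2.
rewrite -/A; set s := \sum_I _; move=> /(_ C1) h.
have s0 : 0 <= s by apply: sumr_ge0 => I _; exact: sqr_ge0.
have : (C + 1)^-1 * (C * s) <= s.
  rewrite mulrA ler_piMl // mulrC ler_pdivrMr // mul1r lerDl //.
have := ler_norm s; lra.
Qed.

Lemma moment_esum :
  (\esum_(i in [set: {ffun 'I_n -> nat}]) ((moment i) ^+ 2)%:E < +oo)%E.
Proof.
apply: (@le_lt_trans _ _ (C + 1)%:E); last exact: ltry.
apply: ub_ereal_sup => _ [X [finX _] <-].
rewrite fsbig_finite //=.
set r := finmap.enum_fset (fset_set X).
have [N hN] : exists N : nat, forall i, i \in r -> forall k, (i k < N)%N.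
  exists (\max_(i <- r) \max_k i k).+1 => i ir k; rewrite ltnS.
  apply: leq_trans (leq_bigmax_seq _ ir isT).
  exact: (leq_bigmax k).
pose emb (I : {ffun 'I_n -> 'I_N}) : {ffun 'I_n -> nat} := [ffun k => I k : nat].
have emb_inj : injective emb.
  move=> I J IJ; apply/ffunP => k; apply: val_inj.
  by have := congr1 (fun f : {ffun 'I_n -> nat} => f k) IJ; rewrite !ffunE.
rewrite sumEFin lee_fin; apply: le_trans (moment_sqr_sum N).
have -> : \sum_(I : {ffun 'I_n -> 'I_N}) moment (fun k => I k) ^+ 2 =
    \sum_(i <- map emb (index_enum {ffun 'I_n -> 'I_N})) moment i ^+ 2.
  rewrite big_map; apply: eq_bigr => I _; congr (_ ^+ 2).
  by rewrite /moment; apply: eq_Rintegral => t _; apply: eq_bigr => k _; rewrite ffunE.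
set s := map emb _.
have rs i : i \in r -> i \in s.
  move=> ir; apply/mapP; exists [ffun k => Ordinal (hN i ir k)].
    exact: mem_index_enum.
  by apply/ffunP => k; rewrite !ffunE.
have us : uniq s by rewrite map_inj_uniq // index_enum_uniq.
have rE : perm_eq r [seq i <- s | i \in r].
  apply: uniq_perm; rewrite ?filter_uniq ?finmap.fset_uniq // => i.
  by rewrite mem_filter; case: (boolP (i \in r)) => //= /rs ->.
rewrite (perm_big _ rE) /= big_filter big_mkcond /=.
by apply: ler_sum => i _; case: ifP => // _; exact: sqr_ge0.
Qed.

Lemma moment_form_hilbert_schmidt :
  hilbert_schmidt ip e (fun xi : 'I_n -> H => moment_form Y nu xi).
Proof.
exists (fun i => moment i); split; first exact: moment_esum.
move=> xi.
have -> : moment_form Y nu xi = \int[nu]_t limit_product xi t.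
  by rewrite /moment_form unlock.
have := @truncated_product_mean_cvg xi.
rewrite (_ : (fun N => \int[nu]_t truncated_product xi N t) = fun N =>
  \sum_(i : {ffun 'I_n -> 'I_N})
    moment [ffun k => val (i k)] * \prod_(k < n) ip (xi k) (e (i k))) //.
apply/funext => N; under eq_Rintegral do rewrite truncated_productE.
rewrite (moment_sum (fun I : {ffun 'I_n -> 'I_N} => \prod_k ip (xi k) (e (I k)))).
apply: eq_bigr => I _; rewrite mulrC; congr (_ * _).
by apply: eq_Rintegral => t _; apply: eq_bigr => k _; rewrite ffunE.
Qed.

Lemma absolute_moment_finite (xi : H) :
  ('E_nu[(fun t => `|Y xi t| ^+ n)%R] < +oo)%E.
Proof.
have mL := measurable_limit_product (fun=> xi).
have [/integrableP[_ +] _] := sqr_integrable_bound mL (limit_product_sqr (fun=> xi)).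
rewrite unlock; apply: le_lt_trans.
rewrite le_eqVlt; apply/orP; left; apply/eqP; apply: eq_integral => t _ /=.
by rewrite /limit_product prodr_const card_ord normrX.
Qed.

End HilbertSchmidt.

Theorem theorem19 (R : realType) (H : completeNormedModType R)
    (ip : {dot H for @idfun R}) (e : nat -> H)
    (d1 : measure_display) (Omega : measurableType d1) (P : probability Omega R)
    (d2 : measure_display) (T : measurableType d2) (mu : probability T R)
    (X : H -> L0 P) (Y : H -> L0 mu)
    (hip : dot_induces_norm ip) (he : orthonormal_basis ip e)
    (hP : standard_probability P) (hmu : standard_probability mu)
    (hX : standard_gaussian X) (hY : randomized_shift e X Y) :
  forall n : nat, exists mu' : probability T R,
    [/\ mu' `<< mu,
        mu `<< mu',
        forall xi : H, ('E_mu'[(fun t => `|Y xi t| ^+ n)%R] < +oo)%E &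
        hilbert_schmidt ip e (@moment_form R H d2 T mu Y mu' n)].
Proof.
move=> n; case: hY => genY shiftY.
pose law := (fun w n => Rinfty_coord e X w.1 n + Rinfty_coord e Y w.2 n) :
  Omega * T -> Rinfty R.
have mlaw : measurable_fun setT law.
  apply: measurable_to_Rinfty => i; apply: measurable_funD.
    exact: (measurableT_comp (L0_measurable _) measurable_fst).
  exact: (measurableT_comp (L0_measurable _) measurable_snd).
have mX : measurable_fun setT (Rinfty_coord e X : Omega -> Rinfty R).
  by apply: measurable_to_Rinfty => i; exact: L0_measurable.
have [w [mw w01 hw]] := @dominated_weight R _ _ _ _ (P \x mu)%E P _ _ _ _ mlaw mX shiftY.
pose W := w \o law.
have mW : measurable_fun setT W by exact: measurableT_comp.
have W01 z : 0 < W z <= 1 by exact: w01.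
have [C C0 hC] := weighted_tensor_bound hip he hX mW W01 hw n.
pose rho := section_mean P W.
have rho01 t : 0 < rho t ^+ n <= 1.
  rewrite exprn_gt0 ?(section_mean_gt0 P mW W01) //=.
  by rewrite exprn_ile1 ?(section_mean_le1 P mW W01) // ltW // (section_mean_gt0 P mW W01).
have mrho : measurable_fun setT (fun t => rho t ^+ n).
  by apply: measurable_funX; exact: measurable_section_mean.
have [nu [c c0 [numu munu nuE]]] := exists_density_probability mu mrho rho01.
have hnu N (A : {ffun 'I_n -> 'I_N} -> R) :
    (\int[nu]_t ((\sum_I A I * \prod_k Y (e (I k)) t) ^+ 2)%:E
      <= (c * C * \sum_I (A I) ^+ 2)%:E)%E.
  rewrite nuE; last 2 first.
  - by move=> t; rewrite lee_fin sqr_ge0.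
  - apply/measurable_EFinP; apply: measurable_funX; apply: measurable_sum => I.
    apply: measurable_funM => //; apply: measurable_prod => k _.
    exact: L0_measurable.
  rewrite -mulrA (EFinM c); refine (@lee_wpmul2l R c%:E _ _ _ _).
    by rewrite lee_fin ltW.
  apply: le_trans (hC N A).
  by under eq_integral do rewrite -EFinM mulrC.
have cC0 : 0 <= c * C by rewrite mulr_ge0 // ltW.
exists nu; split => //.
- by move=> xi; exact: (absolute_moment_finite hip he genY numu cC0 hnu).
- exact: (moment_form_hilbert_schmidt hip he genY numu cC0 hnu).
Qed.
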